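(* Let $n\ge 2$ be an integer. The $\mathcal{S}_n$-lattice $A_{n-1}^{\otimes 2}$ is quasi-permutation if and only if $n=2$ or $n=3$.
   Context: $\mathcal{S}_n$ is the symmetric group on $\{1,\ldots,n\}$. $A_{n-1}=\{(z_1,\ldots,z_n)\in\mathbb{Z}^n\mid\sum_i z_i=0\}$ with $\mathcal{S}_n$ permuting the coordinates of $\mathbb{Z}^n$, and $A_{n-1}^{\otimes 2}=A_{n-1}\otimes_{\mathbb{Z}}A_{n-1}$ with diagonal action. For a finite group $\mathcal{G}$, a $\mathcal{G}$-lattice is a $\mathbb{Z}[\mathcal{G}]$-module that is free of finite rank over $\mathbb{Z}$; a permutation $\mathcal{G}$-lattice is one having a $\mathbb{Z}$-basis permuted by $\mathcal{G}$. A $\mathcal{G}$-lattice $M$ is quasi-permutation if there is an exact sequence of $\mathcal{G}$-lattices $0\to M\to P\to Q\to 0$ with $P,Q$ permutation $\mathcal{G}$-lattices. *)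

(* Defs.v *)
From HB Require Import structures.
From mathcomp Require Import boolp freeg.
From mathcomp Require Import all_boot all_order all_algebra all_fingroup.
From mathcomp Require Import generic_quotient ring_quotient.

Set Implicit Arguments.
Unset Strict Implicit.
Unset Printing Implicit Defensive.

Import GRing.Theory Quotient.
Local Open Scope ring_scope.

Definition zbasis (V : zmodType) (I : finType) (e : I -> V) : Prop :=
  forall x : V, exists! c : {ffun I -> int}, x = \sum_(i : I) e i *~ c i.

(* The group acts on the right, following action.v. As (s * t) i = t (s i) in *)
(* 'S_n, a right 'S_n-module is the same thing as a left module over the      *)
(* symmetric group with the usual composition of maps.                        *)
Record glattice (gT : finGroupType) := GLattice {
  lat_sort :> zmodType;
  lat_act : lat_sort -> gT -> lat_sort;
  lat_act1 : forall x, lat_act x 1%g = x;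
  lat_actM : forall x g h, lat_act x (g * h)%g = lat_act (lat_act x g) h;
  lat_actB : forall g : gT, zmod_morphism (lat_act^~ g);
  lat_free : exists (I : finType) (e : I -> lat_sort), zbasis e
}.

Definition permutation_lattice (gT : finGroupType) (P : glattice gT) : Prop :=
  exists (I : finType) (e : I -> P),
    zbasis e /\ forall (g : gT) (i : I), exists j : I, lat_act (e i) g = e j.

Definition equivariant (gT : finGroupType) (M N : glattice gT) (f : M -> N) :=
  forall (x : M) (g : gT), f (lat_act x g) = lat_act (f x) g.

Definition short_exact (U V W : zmodType) (f : U -> V) (h : V -> W) : Prop :=
  [/\ injective f,
      forall y : V, h y = 0 <-> exists x : U, f x = y
    & forall z : W, exists y : V, h y = z].

Definition quasi_permutation (gT : finGroupType) (M : glattice gT) : Prop :=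
  exists (P Q : glattice gT) (f : {additive M -> P}) (h : {additive P -> Q}),
    [/\ permutation_lattice P, permutation_lattice Q,
        equivariant f, equivariant h & short_exact f h].

(* The tensor product over Z: the free abelian group on A * B modulo the      *)
(* subgroup generated by the biadditivity relations.                          *)
Section Tensor.
Variables A B : zmodType.

Local Notation free_pairs := {freeg (A * B)%type / int}.

Definition pair_gen (a : A) (b : B) : free_pairs := [freeg [:: (1, (a, b))]].

Inductive biadd_rel : free_pairs -> Prop :=
| biadd_rel0 : biadd_rel 0
| biadd_relB x y : biadd_rel x -> biadd_rel y -> biadd_rel (x - y)
| biadd_relDl a a' b :
    biadd_rel (pair_gen (a + a') b - (pair_gen a b + pair_gen a' b))
| biadd_relDr a b b' :
    biadd_rel (pair_gen a (b + b') - (pair_gen a b + pair_gen a b')).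

Definition biadd_pred : {pred free_pairs} := fun x => `[< biadd_rel x >].

Lemma biadd_pred_zmod_closed : zmod_closed biadd_pred.
Proof.
split; first by apply/asboolP; exact: biadd_rel0.
by move=> x y /asboolP xr /asboolP yr; apply/asboolP; exact: biadd_relB.
Qed.

HB.instance Definition _ :=
  GRing.isZmodClosed.Build free_pairs biadd_pred biadd_pred_zmod_closed.

Definition tensor : Type := {quot biadd_pred}.
HB.instance Definition _ := GRing.Zmodule.on tensor.

Definition tens_pi (x : free_pairs) : tensor := \pi_({quot biadd_pred})%qT x.

Lemma tens_piB : zmod_morphism tens_pi.
Proof. by move=> x y; rewrite /tens_pi raddfB. Qed.
HB.instance Definition _ :=
  GRing.isZmodMorphism.Build free_pairs tensor tens_pi tens_piB.

Lemma tens_piP x y : tens_pi x = tens_pi y <-> biadd_rel (x - y).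
Proof.
split=> [/eqP|xy]; last (apply/eqP; move: xy).
  by rewrite -idealrBE => /asboolP.
by move=> xy; rewrite -idealrBE; apply/asboolP.
Qed.

Definition tens (a : A) (b : B) : tensor := tens_pi (pair_gen a b).

Lemma tensDl a a' b : tens (a + a') b = tens a b + tens a' b.
Proof. by rewrite /tens -raddfD; apply/tens_piP; exact: biadd_relDl. Qed.

Lemma tensDr a b b' : tens a (b + b') = tens a b + tens a b'.
Proof. by rewrite /tens -raddfD; apply/tens_piP; exact: biadd_relDr. Qed.

Lemma tens_ind (S : tensor -> Prop) :
    S 0 -> (forall x y, S x -> S y -> S (x - y)) -> (forall a b, S (tens a b)) ->
  forall x, S x.
Proof.
move=> S0 SB St x.
have SN y : S y -> S (- y) by move=> Sy; rewrite -sub0r; apply: SB.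
have SD y z : S y -> S z -> S (y + z).
  by move=> Sy Sz; rewrite -[z]opprK; apply/SB/SN.
have SM y n : S y -> S (y *+ n).
  by move=> Sy; elim: n => [|n IHn]; rewrite ?mulr0n // mulrS; apply: SD.
have -> : x = tens_pi (repr x) by rewrite /tens_pi reprK.
rewrite -(freeg_sumE (repr x)) raddf_sum.
apply: big_ind => // -[a b] _; move: (coeff _ _) => c.
have -> : [freeg [:: (c, (a, b))]] = pair_gen a b *~ c.
  by rewrite /pair_gen freegU_mulz intz.
rewrite raddfMz -/(tens a b).
case: c => n; first by rewrite -pmulrn; exact: SM (St a b).
by rewrite NegzE mulrNz -pmulrn; exact: SN (SM _ _ (St a b)).
Qed.

Definition biadditive (U : zmodType) (phi : A -> B -> U) : Prop :=
  (forall a a' b, phi (a + a') b = phi a b + phi a' b) /\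
  (forall a b b', phi a (b + b') = phi a b + phi a b').

Definition tens_lift (U : zmodType) (phi : A -> B -> U) (x : tensor) : U :=
  fglift (fun ab => phi ab.1 ab.2 : zmodule U) (repr x).

Section Lift.
Variables (U : zmodType) (phi : A -> B -> U).
Hypothesis phiD : biadditive phi.

Let L := fglift (fun ab : A * B => phi ab.1 ab.2 : zmodule U).

Let LB : zmod_morphism L. Proof. exact: lift_is_additive. Qed.
Let L0 : L 0 = 0. Proof. by rewrite -[0 in LHS](subrr 0) LB subrr. Qed.
Let LD x y : L (x + y) = L x + L y.
Proof. by rewrite -[y in LHS]opprK LB -[- y]sub0r LB L0 sub0r opprK. Qed.
Let Lgen a b : L (pair_gen a b) = phi a b.
Proof. by rewrite /L liftU scale1r. Qed.

Let Lrel x : biadd_rel x -> L x = 0.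
Proof.
elim=> {x} [|x y _ Lx _ Ly|a a' b|a b b']; first exact: L0.
- by rewrite LB Lx Ly subrr.
- by rewrite LB LD !Lgen phiD.1 subrr.
- by rewrite LB LD !Lgen phiD.2 subrr.
Qed.

Let lift_pi x : tens_lift phi (tens_pi x) = L x.
Proof.
apply/eqP; rewrite -subr_eq0 /tens_lift -/L -LB; apply/eqP/Lrel/tens_piP.
by rewrite /tens_pi reprK.
Qed.

Lemma tens_liftE a b : tens_lift phi (tens a b) = phi a b.
Proof. by rewrite lift_pi Lgen. Qed.

Lemma tens_liftB : zmod_morphism (tens_lift phi).
Proof.
move=> x y; have reprKt z : z = tens_pi (repr z) by rewrite /tens_pi reprK.
by rewrite (reprKt x) (reprKt y) -tens_piB !lift_pi LB.
Qed.

End Lift.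

Lemma tens_eq (U : zmodType) (f g : tensor -> U) :
    zmod_morphism f -> zmod_morphism g ->
    (forall a b, f (tens a b) = g (tens a b)) ->
  f =1 g.
Proof.
move=> fB gB fg; apply: tens_ind => [|x y fx fy|//].
  by rewrite -(subrr 0) fB gB !subrr.
by rewrite fB gB fx fy.
Qed.

Lemma tens_biadditive : biadditive tens.
Proof. by split; [exact: tensDl | exact: tensDr]. Qed.

Lemma tens_universal (U : zmodType) (phi : A -> B -> U) : biadditive phi ->
  exists f : {additive tensor -> U},
    (forall a b, f (tens a b) = phi a b) /\
    forall f' : {additive tensor -> U},
      (forall a b, f' (tens a b) = phi a b) -> f' =1 f.
Proof.
move=> phiD.
pose m := GRing.isZmodMorphism.Build _ _ (tens_lift phi) (tens_liftB phiD).
pose f : {additive tensor -> U} := HB.pack (tens_lift phi) m.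
exists f; split=> [a b|f' f'E]; first exact: tens_liftE.
apply: tens_eq => [||a b]; [exact: raddfB | exact: raddfB |].
by rewrite f'E; symmetry; exact: tens_liftE.
Qed.

Lemma tens_suml (I : finType) (F : I -> A) b :
  tens (\sum_i F i) b = \sum_i tens (F i) b.
Proof.
elim/big_rec2: _ => [|i y1 y2 _ <-]; last by rewrite tensDl.
by apply: (@addrI _ (tens 0 b)); rewrite -tensDl !addr0.
Qed.

Lemma tens_sumr (I : finType) a (F : I -> B) :
  tens a (\sum_i F i) = \sum_i tens a (F i).
Proof.
elim/big_rec2: _ => [|i y1 y2 _ <-]; last by rewrite tensDr.
by apply: (@addrI _ (tens a 0)); rewrite -tensDr !addr0.
Qed.

End Tensor.

Lemma additive_Mz (U V : zmodType) (f : U -> V) :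
  zmod_morphism f -> forall x k, f (x *~ k) = f x *~ k.
Proof.
move=> fB x k.
pose m := GRing.isZmodMorphism.Build _ _ f fB.
pose F : {additive U -> V} := HB.pack f m.
exact: (raddfMz F).
Qed.

Lemma additive_sum (U V : zmodType) (f : U -> V) (I : finType) (F : I -> U) :
  zmod_morphism f -> f (\sum_i F i) = \sum_i f (F i).
Proof.
move=> fB.
pose m := GRing.isZmodMorphism.Build _ _ f fB.
pose h : {additive U -> V} := HB.pack f m.
exact: (raddf_sum h).
Qed.

Lemma nmod_zmod_morphism (U V : zmodType) (f : U -> V) :
  (forall x y, f (x + y) = f x + f y) -> zmod_morphism f.
Proof.
move=> fD x y; apply: (@addIr _ (f y)).
by rewrite -fD !addrNK.
Qed.

Lemma zmod_morphismD (U V : zmodType) (f : U -> V) :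
  zmod_morphism f -> forall x y, f (x + y) = f x + f y.
Proof.
move=> fB x y; pose m := GRing.isZmodMorphism.Build _ _ f fB.
pose h : {additive U -> V} := HB.pack f m.
exact: (raddfD h).
Qed.

Lemma zbasis_coord (V : zmodType) (I : finType) (e : I -> V) : zbasis e ->
  exists c : I -> V -> int,
    [/\ forall i, zmod_morphism (c i),
        forall x, x = \sum_i e i *~ c i x
      & forall i j, c i (e j) = (i == j)%:R].
Proof.
move=> eb; have /choice[c cP] : forall x, exists c : {ffun I -> int},
    x = \sum_i e i *~ c i /\
    forall c' : {ffun I -> int}, x = \sum_i e i *~ c' i -> c' = c.
  by move=> x; have [c [xc cu]] := eb x; exists c; split=> // c' /cu.
have cE x : x = \sum_i e i *~ c x i by have [] := cP x.
exists (fun i x => c x i); split=> // [i x y|i j].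
  suff <- : [ffun i => c x i - c y i] = c (x - y) by rewrite ffunE.
  apply: (cP (x - y)).2; rewrite {1}(cE x) {1}(cE y) -sumrB.
  by apply: eq_bigr => k _; rewrite ffunE mulrzBr.
suff <- : [ffun i => (i == j)%:R] = c (e j) by rewrite ffunE.
apply: (cP (e j)).2; rewrite (bigD1 j) //= big1 => [|k /negPf kj].
  by rewrite ffunE eqxx mulr1z addr0.
by rewrite ffunE kj mulr0z.
Qed.

Lemma zbasis_tens (A B : zmodType) (I J : finType) (e : I -> A) (f : J -> B) :
  zbasis e -> zbasis f -> zbasis (fun k : I * J => tens (e k.1) (f k.2)).
Proof.
move=> /zbasis_coord[c [cB cE ce]] /zbasis_coord[d [dB dE df]].
pose phi i j (a : A) (b : B) := c i a * d j b.
have phiD i j : biadditive (phi i j).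
  split=> [a a' b|a b b'].
    by rewrite /phi (zmod_morphismD (cB i)) mulrDl.
  by rewrite /phi (zmod_morphismD (dB j)) mulrDr.
pose l i j := tens_lift (phi i j); have lB i j : zmod_morphism (l i j).
  exact: tens_liftB.
have lE i j a b : l i j (tens a b) = c i a * d j b by exact: tens_liftE.
have span x : x = \sum_(k : I * J) tens (e k.1) (f k.2) *~ l k.1 k.2 x.
  apply: (tens_eq (f := id) (g := fun x =>
    \sum_(k : I * J) tens (e k.1) (f k.2) *~ l k.1 k.2 x)).
  - by [].
  - by move=> y z; rewrite -sumrB; apply: eq_bigr => k _; rewrite lB mulrzBr.
  move=> a b; rewrite {1}(cE a) {1}(dE b) tens_suml.
  transitivity (\sum_i \sum_j tens (e i) (f j) *~ l i j (tens a b)).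
    apply: eq_bigr => i _; rewrite tens_sumr; apply: eq_bigr => j _.
    rewrite lE.
    rewrite (additive_Mz (f := fun u => tens u _)); last first.
      by apply: nmod_zmod_morphism => u v; rewrite tensDl.
    rewrite (additive_Mz (f := fun u => tens _ u)); last first.
      by apply: nmod_zmod_morphism => u v; rewrite tensDr.
    by rewrite -mulrzA mulrC.
  by rewrite pair_big.
move=> x; exists [ffun k => l k.1 k.2 x]; split=> [|g xg].
  by rewrite {1}(span x); apply: eq_bigr => k _; rewrite ffunE.
apply/ffunP=> -[i j]; rewrite ffunE /= xg additive_sum //.
rewrite (bigD1 (i, j)) //= big1 => [|[i' j'] /= ne].
  by rewrite (additive_Mz (lB i j)) lE ce df !eqxx mulr1 addr0 intz.
rewrite (additive_Mz (lB i j)) lE ce df.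
have [ii'|_] := eqVneq i i'; last by rewrite mul0r mul0rz.
have [jj'|_] := eqVneq j j'; last by rewrite mulr0 mul0rz.
by rewrite ii' jj' eqxx in ne.
Qed.

Section TensorLattice.
Variables (gT : finGroupType) (M N : glattice gT).

(* The diagonal action: (x (x) y) g = x g (x) y g.                            *)
Definition tens_act (x : tensor M N) (g : gT) : tensor M N :=
  tens_lift (fun (a : M) (b : N) => tens (lat_act a g) (lat_act b g)) x.

Let diagD (g : gT) :
  biadditive (fun (a : M) (b : N) => tens (lat_act a g) (lat_act b g)).
Proof.
split=> [a a' b|a b b'].
  by rewrite (zmod_morphismD (lat_actB g)) tensDl.
by rewrite (zmod_morphismD (lat_actB g)) tensDr.
Qed.

Lemma tens_actE a b g :
  tens_act (tens a b) g = tens (lat_act a g) (lat_act b g).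
Proof. exact: (tens_liftE (diagD g)). Qed.

Lemma tens_actB g : zmod_morphism (tens_act^~ g).
Proof. exact: (tens_liftB (diagD g)). Qed.

Lemma tens_act1 x : tens_act x 1%g = x.
Proof.
move: x; apply: tens_eq => [||a b] //; first exact: tens_actB.
by rewrite tens_actE !lat_act1.
Qed.

Lemma tens_actM x g h : tens_act x (g * h)%g = tens_act (tens_act x g) h.
Proof.
apply: (tens_eq (f := tens_act^~ (g * h)%g)
  (g := fun x => tens_act (tens_act x g) h)) => [|y z|a b].
- exact: tens_actB.
- by rewrite !tens_actB.
by rewrite !tens_actE !lat_actM.
Qed.

Lemma tensor_free :
  exists (I : finType) (e : I -> tensor M N), zbasis e.
Proof.
have [I [e eb]] := lat_free M; have [J [f fb]] := lat_free N.
by exists (I * J)%type, (fun k => tens (e k.1) (f k.2)); exact: zbasis_tens.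
Qed.

Definition tensor_lattice : glattice gT :=
  @GLattice gT (tensor M N) tens_act tens_act1 tens_actM
    tens_actB tensor_free.

End TensorLattice.

(* The 'S_n-lattice of rank n - 1 that is usually denoted A_(n-1).            *)
Section RootLattice.
Variable n : nat.

Definition sum_zero : {pred 'rV[int]_n} := fun z => \sum_i z 0 i == 0.

Lemma sum_zero_zmod_closed : zmod_closed sum_zero.
Proof.
split; first by apply/eqP; rewrite big1 // => i _; rewrite mxE.
move=> x y /eqP x0 /eqP y0; apply/eqP.
under eq_bigr do rewrite !mxE.
by rewrite sumrB x0 y0 subrr.
Qed.

HB.instance Definition _ :=
  GRing.isZmodClosed.Build 'rV[int]_n sum_zero sum_zero_zmod_closed.

Record root_vec := RootVec { root_val :> 'rV[int]_n; _ : root_val \in sum_zero }.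

HB.instance Definition _ := [isSub for root_val].
HB.instance Definition _ := [Choice of root_vec by <:].
HB.instance Definition _ := [SubChoice_isSubZmodule of root_vec by <:].

Lemma perm_sum_zero (z : root_vec) (s : 'S_n) : col_perm s^-1 z \in sum_zero.
Proof.
apply/eqP; under eq_bigr do rewrite mxE.
rewrite (reindex_inj (@perm_inj _ s)) /=.
by under eq_bigr do rewrite permK; exact/eqP/(valP z).
Qed.

(* (z s)_(s i) = z_i, so that s sends the i-th unit vector to the (s i)-th.   *)
Definition root_act (z : root_vec) (s : 'S_n) : root_vec := RootVec (perm_sum_zero z s).

Lemma root_act1 z : root_act z 1%g = z.
Proof. by apply: val_inj; rewrite /= invg1 col_perm1. Qed.

Lemma root_actM z s t : root_act z (s * t)%g = root_act (root_act z s) t.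
Proof. by apply: val_inj; rewrite /= invMg col_permM. Qed.

Lemma root_actB s : zmod_morphism (root_act^~ s).
Proof. by move=> x y; apply: val_inj; apply/rowP=> i; rewrite !mxE. Qed.

End RootLattice.

Lemma root_free n : exists (I : finType) (e : I -> root_vec n), zbasis e.
Proof.
case: n => [|n].
  exists 'I_0, (fun=> 0) => x; exists [ffun=> 0]; split=> [|c _].
    by rewrite big_ord0; apply: val_inj; apply/rowP=> -[].
  by apply/ffunP=> -[].
have eP i : delta_mx 0 (lift ord0 i) - delta_mx 0 ord0 \in @sum_zero n.+1.
  have sd j : \sum_k (delta_mx 0 j : 'rV[int]_n.+1) 0 k = 1.
    rewrite (bigD1 j) //= big1 => [|k /negPf kj]; first by rewrite mxE !eqxx.
    by rewrite mxE kj andbF.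
  apply/eqP; under eq_bigr do rewrite mxE [X in _ + X]mxE.
  by rewrite sumrB !sd subrr.
pose e i := RootVec (eP i).
have cB j : zmod_morphism (fun z : root_vec n.+1 => root_val z 0 j).
  by move=> y z; rewrite !mxE.
have eE (c : 'I_n -> int) j :
    root_val (\sum_i e i *~ c i) 0 (lift ord0 j) = c j.
  rewrite (additive_sum _ (cB _)) (bigD1 j) //= big1 => [|k kj].
    rewrite (additive_Mz (cB _)) /= !mxE !eqxx.
    by rewrite addr0 subr0 intz.
  rewrite (additive_Mz (cB _)) /= !mxE (inj_eq lift_inj) eq_sym (negPf kj).
  by rewrite subrr mul0rz.
exists 'I_n, e => x; exists [ffun i => x 0 (lift ord0 i)]; split=> [|c ->].
  pose y : root_vec n.+1 := \sum_i e i *~ [ffun i => x 0 (lift ord0 i)] i.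
  have xy j : x 0 (lift ord0 j) = y 0 (lift ord0 j) by rewrite eE ffunE.
  apply: (etrans _ (erefl y)); apply: val_inj; apply/rowP=> i.
  have [j ->|->] := unliftP ord0 i; first exact: xy.
  have /eqP := valP x; have /eqP := valP y; rewrite /sum_zero !big_ord_recl.
  move=> /(canRL (addrK _)) -> /(canRL (addrK _)) ->.
  by rewrite (eq_bigr _ (fun j _ => xy j)).
by apply/ffunP=> j; rewrite ffunE eE.
Qed.

Definition root_lattice (n : nat) : glattice 'S_n :=
  @GLattice 'S_n (root_vec n) (@root_act n) (@root_act1 n) (@root_actM n)
    (@root_actB n) (root_free n).

(* Main.v *)
Require Import Defs.
From HB Require Import structures.
From mathcomp Require Import boolp.
From mathcomp Require Import all_boot all_order all_algebra all_fingroup.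
From mathcomp Require Import cyclic zify ring.

(** Let A be the root lattice and M its tensor square. The tensor product of A
    with Z^n has a permuted basis, and M is the kernel of its projection to A.
    In graph terms, an element of M is a circulation on the complete digraph
    with n vertices; if loops are allowed, the kernel of the boundary map from
    Z^(n x n) to A is M + Z^n (circ_tens and tens_matrix compare the two). Hence
    if M is quasi-permutation, the lattice T of circulations is the kernel of a
    surjection P -> Q of permutation lattices, for every group acting on the n
    vertices (quasi_permutation_root_square and
    quasi_permutation_circulations_restrict). A well chosen group then gives a
    contradiction for n > 3. Two facts on a permutation lattice are used
    throughout: its first cohomology vanishes, and its invariants modulo an
    integer lift to invariants.

    For n composite, a class in the first cohomology of T modulo p that is
    trivial on every cyclic subgroup must lift to an integral class
    (invariant_boundary_lift). Let p be the least prime factor of n = m p, so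
    that m >= p. The group F_p^2 acts on n points: by translations if m = p, and
    if m > p with m orbits of length p, such that all p + 1 subgroups of order p
    occur as stabilisers. In both cases there is a class of this kind without
    such a lift.

    For n = p prime, let C be generated by the translation x |-> x + 1 of F_p and
    let t be the permutation x |-> 2 x, which normalises C. The degree-zero Tate
    cohomology of T over C is a line, generated by the cycle through the arcs
    x -> x + 1 and multiplied by 2 under t, while the first cohomology of T
    vanishes. So there is an exact sequence 0 -> F_p -> F_p^X -> F_p^Y -> 0,
    where X and Y are the sets of basis elements of P and Q that C fixes. The
    traces of t and of its inverse on F_p^X both count the fixed points of t in
    X, and likewise for Y. So the traces 2 and 1/2 on the line are equal in F_p,
    and p divides 3 (fixed_point_trace).

    For n = 2 the group acts trivially on M. For n = 3 a circulation is a
    combination of the three two-way edges and the two oriented triangles, and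
    the only relation is that the sum of the edges is the sum of the triangles.
    The five coefficients may be normalised, in exactly one way, so as to have sum
    zero, because the relation itself has coefficient sum 3 - 2 = 1. So M is the
    kernel of the sum map from a permutation lattice of rank 5 to Z. *)

Set Implicit Arguments.
Unset Strict Implicit.
Unset Printing Implicit Defensive.

Import GRing.Theory Num.Theory.
Local Open Scope ring_scope.

(** * Cohomology of permutation lattices *)

Section PermutationModule.
Variables (gT : finGroupType) (I : finType) (to : {action gT &-> I}).

(** The right action for which g sends the unit function at i to the one at
    to i g. *)
Definition translate (g : gT) (x : {ffun I -> int}) : {ffun I -> int} :=
  [ffun i => x (to i g^-1%g)].

Lemma translateB g : zmod_morphism (translate g).
Proof. by move=> x y; apply/ffunP=> i; rewrite !ffunE. Qed.

HB.instance Definition _ g :=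
  GRing.isZmodMorphism.Build _ _ (translate g) (translateB g).

Lemma translate_act g x i : translate g x (to i g) = x i.
Proof. by rewrite ffunE actK. Qed.

Lemma translate1 x : translate 1 x = x.
Proof. by apply/ffunP=> i; rewrite ffunE invg1 act1. Qed.

Lemma translateM g h x : translate (g * h) x = translate h (translate g x).
Proof. by apply/ffunP=> i; rewrite !ffunE invMg actM. Qed.

Definition unit_fun (i : I) : {ffun I -> int} := [ffun j => (j == i)%:R].

Lemma translate_unit g i : translate g (unit_fun i) = unit_fun (to i g).
Proof.
apply/ffunP=> j; rewrite !ffunE; congr (_%:R).
by rewrite (canF_eq (actKV to g)).
Qed.

Lemma unit_fun_sum (x : {ffun I -> int}) : x = \sum_i unit_fun i *~ x i.
Proof.
apply/ffunP=> j; rewrite sum_ffunE (bigD1 j) //= big1 => [|i ij].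
  by rewrite ffunMzE ffunE eqxx addr0 intz.
by rewrite ffunMzE ffunE eq_sym (negPf ij) mul0rz.
Qed.

Lemma ffun_mulrn_inj (d : nat) (x y : {ffun I -> int}) :
  (0 < d)%N -> x *+ d = y *+ d -> x = y.
Proof.
move=> d0 xy; apply/ffunP=> i.
have := congr1 (fun f : {ffun I -> int} => f i) xy; rewrite !ffunMnE.
by apply: pmulrnI.
Qed.

(** Reducing every coordinate modulo d keeps it constant on orbits: this is why
    an element that is invariant modulo d lifts to an invariant element. *)
Lemma invariant_lift (G : {group gT}) (d : nat) (x : {ffun I -> int}) :
    (forall g, g \in G -> exists z, translate g x - x = z *+ d) ->
  exists x0 z, (forall g, g \in G -> translate g x0 = x0) /\ x = x0 + z *+ d.
Proof.
move=> xG; exists [ffun i => (x i %% d)%Z], [ffun i => (x i %/ d)%Z].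
split=> [g gG|]; apply/ffunP=> i; rewrite !ffunE; last first.
  by rewrite ffunMnE ffunE -mulr_natr natz addrC -divz_eq.
have [z /(congr1 (fun f : {ffun I -> int} => f i))] := xG g gG.
rewrite !ffunE ffunMnE => xz.
apply/eqP; rewrite eqz_mod_dvd xz -mulr_natr natz.
by rewrite dvdz_mull.
Qed.

(** The sum S of a cocycle F over G satisfies |G| F(g) = S - S g. So S is
    invariant modulo |G|, and after subtracting an invariant lift one can divide
    the equation by |G|. *)
Lemma cocycle_coboundary (G : {group gT}) (F : gT -> {ffun I -> int}) :
    (forall g h, g \in G -> h \in G -> F (g * h)%g = translate h (F g) + F h) ->
  exists y, forall g, g \in G -> F g = translate g y - y.
Proof.
move=> FM; pose S := \sum_(k in G) F k.
have SE g : g \in G -> S = translate g S + F g *+ #|G|.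
  move=> gG; rewrite {1}/S (reindex_inj (mulIg g)) /= raddf_sum -sumr_const.
  rewrite -big_split /=; apply: eq_big => [k|k]; first by rewrite groupMr.
  by rewrite groupMr // => kG; rewrite FM.
have [g gG|S0 [z [S0G SS0]]] := @invariant_lift G #|G| S.
  by exists (- F g); rewrite {2}(SE g gG) opprD addNKr mulNrn.
exists (- z) => g gG; apply: (@ffun_mulrn_inj #|G|); first exact: cardG_gt0.
have -> : F g *+ #|G| = S - translate g S by rewrite {1}(SE g gG) addrC addKr.
rewrite SS0 raddfD /= S0G // raddfMn raddfN /= mulrnDl mulNrn opprK.
by rewrite opprD addrACA subrr add0r addrC.
Qed.

Lemma orbit_repr (G : {group gT}) :
  exists r : I -> I, forall i, [/\ r i \in orbit to G i
    & forall g, g \in G -> r (to i g) = r i].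
Proof.
exists (fun i => odflt i [pick j in orbit to G i]) => i; split=> [|g gG].
  by case: pickP => [j //|/(_ i)]; rewrite orbit_refl.
rewrite orbit_act //; case: pickP => // /(_ i); by rewrite orbit_refl.
Qed.

(** By Shapiro's lemma a class in the first cohomology modulo d is given by
    homomorphisms from the stabilisers of points to Z/d, and the second hypothesis
    makes these zero. In coordinates: the value of c at i is read off along any
    path from the base point of the orbit, and the vanishing on the stabiliser
    makes the choice of the path immaterial. *)
Lemma cocycle_coboundary_mod (G : {group gT}) (d : nat)
    (F : gT -> {ffun I -> int}) :
    (forall g h, g \in G -> h \in G ->
       exists z, F (g * h)%g = translate h (F g) + F h + z *+ d) ->
    (forall g i, g \in G -> to i g = i -> (d %| F g i)%Z) ->
  exists c, forall g, g \in G -> exists z, F g = translate g c - c + z *+ d.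
Proof.
move=> FM Fst; have [r rP] := orbit_repr G.
have FMi g h i : g \in G -> h \in G ->
    (d %| F (g * h)%g i - (F g (to i h^-1%g) + F h i))%Z.
  move=> gG hG; have [z ->] := FM g h gG hG; rewrite !ffunE addrAC subrr add0r.
  by rewrite ffunMnE -mulr_natr natz dvdz_mull.
have /choice[k kP] : forall i, exists k, k \in G /\ to (r i) k = i.
  move=> i; have [/orbitP[g gG gi] _] := rP i.
  by exists g^-1%g; rewrite groupV -gi actK.
pose c := [ffun i => - F (k i) i]; exists c => g gG.
suff dF i : (d %| F g i - (translate g c - c) i)%Z.
  move: (translate g c - c) dF => e dF; exists [ffun i => ((F g i - e i) %/ d)%Z].
  apply/ffunP=> i; rewrite ffunE ffunMnE ffunE -mulr_natr natz divzK //.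
  by rewrite addrC subrK.
pose j := to i g^-1%g; have [kiG ki] := kP i; have [kjG kj] := kP j.
have rij : r j = r i by have [_ ->] := rP i; rewrite ?groupV.
pose s := (k j * g * (k i)^-1)%g.
have sG : s \in G by rewrite !groupM ?groupV.
have sr : to (r i) s = r i by rewrite !actM -rij kj actKV -{1}ki rij actK.
have h1 := FMi _ _ i kjG gG; have h2 := FMi _ _ i sG kiG.
have h3 := Fst _ _ sG sr.
have kV : to i (k i)^-1%g = r i by rewrite -{1}ki actK.
move: h2; rewrite /s mulgKV kV -/s => h2.
rewrite !ffunE -/j.
suff -> : F g i - (- F (k j) j - - F (k i) i) =
    (F (k j * g)%g i - (F s (r i) + F (k i) i)) + F s (r i)
    - (F (k j * g)%g i - (F (k j) (to i g^-1)%g + F g i)).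
  by rewrite rpredB // rpredD.
rewrite -/j; lia.
Qed.

Definition norm (G : {group gT}) x := \sum_(g in G) translate g x.

Lemma normB G : zmod_morphism (norm G).
Proof.
by move=> x y; rewrite /norm -sumrB; apply: eq_bigr => g _; rewrite raddfB.
Qed.

HB.instance Definition _ G :=
  GRing.isZmodMorphism.Build _ _ (norm G) (normB G).

Lemma translate_norm (G : {group gT}) g x :
  g \in G -> translate g (norm G x) = norm G x.
Proof.
move=> gG; rewrite /norm raddf_sum [RHS](reindex_inj (mulIg g)) /=.
by apply: eq_big => [h|h _]; rewrite ?groupMr // translateM.
Qed.

Lemma norm_fixed (G : {group gT}) x i :
  (forall g, g \in G -> to i g = i) -> norm G x i = x i *+ #|G|.
Proof.
move=> iG; rewrite /norm sum_ffunE -sumr_const; apply: eq_bigr => g gG.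
by rewrite ffunE iG ?groupV.
Qed.

(** The norm of the unit function at a point is constant on the orbit of that
    point, with the order of the stabiliser as its value. *)
Lemma invariant_norm (G : {group gT}) x :
    (forall g, g \in G -> translate g x = x) ->
    (forall i, (#|('C_G[i | to])%g| %| x i)%Z) ->
  exists y, x = norm G y.
Proof.
move=> xG xd; have [r rP] := orbit_repr G.
have xact i g : g \in G -> x (to i g) = x i.
  by move=> gG; rewrite -{1}(xG g gG) translate_act.
exists [ffun i => if r i == i then (x i %/ #|('C_G[i | to])%g|)%Z else 0].
apply/ffunP=> i; have [/orbitP[k kG ki] _] := rP i.
have rr : r (r i) = r i by rewrite -{1}ki; have [_ ->] := rP i.
have rV g : g \in G -> r (to i g^-1%g) = r i.
  by move=> gG; have [_ ->] := rP i; rewrite ?groupV.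
transitivity (\sum_(g in G | to i g^-1%g == r i)
    (x (r i) %/ #|('C_G[r i | to])%g|)%Z); last first.
  rewrite /norm sum_ffunE big_mkcondr /=; apply: eq_bigr => g gG.
  rewrite !ffunE rV // [r i == _]eq_sym.
  by case: eqP => [->|].
rewrite sumr_const -mulr_natr natz.
have -> : #|[pred g | g \in G & to i g^-1%g == r i]| = #|('C_G[r i | to])%g|.
  rewrite -(card_rcoset _ k^-1); apply: eq_card => g.
  rewrite inE mem_rcoset inE invgK (_ : ((g * k)%g \in 'C[r i | to]%g) =
      (to (r i) (g * k)%g == r i)); last by rewrite !inE sub1set inE.
  rewrite groupMr // actM; congr (_ && _).
  rewrite (canF_eq (actKV to g)) eq_sym -[RHS](inj_eq (act_inj to k^-1%g)) actK.
  by rewrite -[X in _ == to X _]ki actK.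
rewrite divzK //.
by rewrite -ki xact.
Qed.

(** The weighted sum of the k x g^k solves the equation up to the factor #[g], and
    it is invariant modulo #[g]: subtracting an invariant lift, one can divide. *)
Lemma norm_eq0 (g : gT) x : norm <[g]> x = 0 -> exists y, x = translate g y - y.
Proof.
move=> Nx; pose d := #[g]%g; pose y := \sum_(k < d) translate (g ^+ k)%g x *+ k.
have sumE : \sum_(k < d) translate (g ^+ k)%g x = 0.
  rewrite -[RHS]Nx /norm /=.
  have -> : <[g]>%g = [set (g ^+ (k : 'I_d))%g | k : 'I_d] :> {set gT}.
    apply/setP=> h; apply/idP/imsetP=> [/cyclePmin[k kd ->]|[k _ ->]].
      by exists (Ordinal kd).
    exact: mem_cycle.
  rewrite big_imset /=; first by apply: eq_bigl.
  move=> k l _ _ /eqP.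
  rewrite eq_expg_mod_order -/d !modn_small ?ltn_ord // => kl.
  exact/val_inj/eqP.
have yE : translate g y - y = x *+ d.
  rewrite {1}/y raddf_sum /=.
  under eq_bigr do rewrite raddfMn /= -translateM -expgSr.
  have d0 : (0 < d)%N := order_gt0 g.
  have tele : \sum_(k < d) (translate (g ^+ k.+1)%g x *+ k.+1
      - translate (g ^+ k)%g x *+ k) = x *+ d.
    rewrite -(big_mkord xpredT (fun k => translate (g ^+ k.+1)%g x *+ k.+1
      - translate (g ^+ k)%g x *+ k)).
    rewrite (telescope_sumr (fun k => translate (g ^+ k)%g x *+ k)) //.
    by rewrite mulr0n subr0 expg_order translate1.
  have shift : \sum_(k < d) translate (g ^+ k.+1)%g x = 0.
    have := congr1 (translate g) sumE; rewrite raddf_sum raddf0 /= => e0.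
    rewrite -[RHS]e0.
    by apply: eq_bigr => k _; rewrite expgSr translateM.
  rewrite -tele sumrB; congr (_ - _).
  under [RHS]eq_bigr do rewrite mulrSr.
  by rewrite big_split /= shift addr0.
have [h|y0 [z [y0G yz]]] := @invariant_lift <[g]> d y.
  case/cycleP=> k ->; elim: k => [|k [z IH]].
    by exists 0; rewrite expg0 translate1 subrr mul0rn.
  exists (translate g z + x); rewrite expgSr translateM mulrnDl -raddfMn -IH -yE.
  by rewrite raddfB addrA subrK.
exists z; apply: (@ffun_mulrn_inj d); first exact: order_gt0.
rewrite -yE yz raddfD /= y0G ?cycle_id // raddfMn opprD addrACA subrr add0r.
by rewrite mulrnBl.
Qed.

End PermutationModule.

(** * Circulations *)

Section Arcs.
Variables (gT : finGroupType) (W : finType) (to : {action gT &-> W}).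

Definition arc_move (a : W * W) (g : gT) := (to a.1 g, to a.2 g).

Lemma arc_move1 : arc_move^~ 1%g =1 id.
Proof. by case=> i j; rewrite /arc_move !act1. Qed.

Lemma arc_moveM a : act_morph arc_move a.
Proof. by move=> g h; rewrite /arc_move !actM. Qed.

Definition arc_action : {action gT &-> W * W} :=
  TotalAction arc_move1 arc_moveM.

(** Inflow minus outflow. *)
Definition boundary (x : {ffun W * W -> int}) : {ffun W -> int} :=
  [ffun k => \sum_i x (i, k) - \sum_j x (k, j)].

Lemma boundaryB : zmod_morphism boundary.
Proof.
move=> x y; apply/ffunP=> k; rewrite !ffunE.
under eq_bigr do rewrite !ffunE; under [X in _ - X]eq_bigr do rewrite !ffunE.
by rewrite !sumrB; ring.
Qed.

HB.instance Definition _ :=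
  GRing.isZmodMorphism.Build _ _ boundary boundaryB.

Lemma boundary_translate g x :
  boundary (translate arc_action g x) = translate to g (boundary x).
Proof.
apply/ffunP=> k; rewrite !ffunE; congr (_ - _).
  rewrite [RHS](reindex_inj (act_inj to g^-1%g)) /=.
  by apply: eq_bigr => i _; rewrite ffunE.
rewrite [RHS](reindex_inj (act_inj to g^-1%g)) /=.
by apply: eq_bigr => i _; rewrite ffunE.
Qed.

Lemma sum_boundary x : \sum_k boundary x k = 0.
Proof.
under eq_bigr do rewrite ffunE.
by rewrite sumrB exchange_big /= subrr.
Qed.

Lemma boundary_arc i j : boundary (unit_fun (i, j)) = unit_fun j - unit_fun i.
Proof.
apply/ffunP=> k; rewrite !ffunE; congr (_ - _).
  rewrite (bigD1 i) //= ffunE xpair_eqE eqxx big1 ?addr0 // => l il.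
  by rewrite ffunE xpair_eqE (negPf il).
rewrite (bigD1 j) //= ffunE xpair_eqE eqxx andbT big1 ?addr0 // => l jl.
by rewrite ffunE xpair_eqE (negPf jl) andbF.
Qed.

End Arcs.

(** The exact sequence 0 -> T -> Z^I -> Z^J -> 0 of the lattice T of circulations.
    The map f is additive on all functions on arcs, but only its restriction to
    T is equivariant and injective. *)
Record circulation_sequence (gT : finGroupType) (W I J : finType)
    (to : {action gT &-> W}) (toI : {action gT &-> I}) (toJ : {action gT &-> J})
    (f : {additive {ffun W * W -> int} -> {ffun I -> int}})
    (h : {additive {ffun I -> int} -> {ffun J -> int}}) : Prop :=
  CirculationSequence {
    circ_equiv : forall g x, boundary x = 0 ->
      f (translate (arc_action to) g x) = translate toI g (f x);
    perm_equiv : forall g y, h (translate toI g y) = translate toJ g (h y);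
    circ_inj : forall x, boundary x = 0 -> f x = 0 -> x = 0;
    circ_exact : forall y, h y = 0 <-> exists2 x, boundary x = 0 & f x = y;
    perm_surj : forall z, exists y, h y = z }.

Definition quasi_permutation_circulations (gT : finGroupType) (W : finType)
    (to : {action gT &-> W}) : Prop :=
  exists (I J : finType) (toI : {action gT &-> I}) (toJ : {action gT &-> J})
    (f : {additive {ffun W * W -> int} -> {ffun I -> int}})
    (h : {additive {ffun I -> int} -> {ffun J -> int}}),
  circulation_sequence to toI toJ f h.

(** A permuted basis gives a group action on its index set because its elements
    are distinct. *)
Lemma permutation_lattice_coord (gT : finGroupType) (P : glattice gT) :
    permutation_lattice P ->
  exists (I : finType) (to : {action gT &-> I})
    (c : {additive P -> {ffun I -> int}}) (d : {additive {ffun I -> int} -> P}),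
  [/\ cancel c d, cancel d c
    & forall x g, c (lat_act x g) = translate to g (c x)].
Proof.
move=> [I [e [eb eperm]]]; have [c [cB cE ce]] := zbasis_coord eb.
have einj : injective e.
  move=> i j eij; have := ce i j; rewrite -eij ce eqxx.
  by case: eqP.
have /choice[u uP] : forall k : I * gT, exists j, lat_act (e k.1) k.2 = e j.
  by move=> [i g]; have [j ej] := eperm g i; exists j.
pose mv i g := u (i, g).
have eM i g : e (mv i g) = lat_act (e i) g by rewrite -(uP (i, g)).
have mv1 : mv^~ 1%g =1 id by move=> i; apply: einj; rewrite eM lat_act1.
have mvM i : act_morph mv i by move=> g h; apply: einj; rewrite !eM lat_actM.
pose to : {action gT &-> I} := TotalAction mv1 mvM.
pose C x := [ffun i => c i x].
have CB : zmod_morphism C by move=> x y; apply/ffunP=> i; rewrite !ffunE cB.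
pose D (y : {ffun I -> int}) := \sum_i e i *~ y i.
have DB : zmod_morphism D.
  move=> x y; rewrite /D -sumrB; apply: eq_bigr => i _.
  by rewrite !ffunE mulrzBr.
pose mC := GRing.isZmodMorphism.Build _ _ C CB.
pose mD := GRing.isZmodMorphism.Build _ _ D DB.
pose C' : {additive P -> {ffun I -> int}} := HB.pack C mC.
pose D' : {additive {ffun I -> int} -> P} := HB.pack D mD.
have ciM i x k : c i (x *~ k) = c i x *~ k by exact: additive_Mz.
have cisum i (J : finType) (F : J -> P) : c i (\sum_j F j) = \sum_j c i (F j).
  exact: additive_sum.
exists I, to, C', D'; split=> [x|y|x g].
- by rewrite [RHS]cE; apply: eq_bigr => i _; rewrite ffunE.
- apply/ffunP=> i; rewrite ffunE cisum (bigD1 i) //= big1 => [|j ji].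
    by rewrite ciM ce eqxx addr0 intz.
  by rewrite ciM ce eq_sym (negPf ji) mul0rz.
apply/ffunP=> j; rewrite !ffunE {1}(cE x).
have aB := @lat_actB _ P g.
rewrite (additive_sum _ aB) cisum (bigD1 (to j g^-1%g)) //= big1 => [|i ij].
  rewrite (additive_Mz aB) -eM ciM ce.
  by rewrite (_ : mv _ g = j) ?eqxx ?intz ?addr0 //; exact: (actKV to g).
rewrite (additive_Mz aB) -eM ciM ce; case: eqP => [jE|_]; last by rewrite mul0rz.
have jK : mv j g^-1%g = i by rewrite jE; exact: (actK to g).
by rewrite jK eqxx in ij.
Qed.

(** * The tensor square of the root lattice *)

Lemma sum_pairs (U V : finType) (T : zmodType) (F : U * V -> T) :
  \sum_k F k = \sum_i \sum_j F (i, j).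
Proof. by rewrite pair_bigA; apply: eq_bigr => -[]. Qed.

Section TensorSquare.
Variable n : nat.
Local Notation root := (root_vec n.+1).
Local Notation arcs := ('I_n.+1 * 'I_n.+1)%type.
Local Notation square := (tensor root root).

Lemma root_diff_sum_zero (i j : 'I_n.+1) :
  delta_mx 0 i - delta_mx 0 j \in @sum_zero n.+1.
Proof.
have sd l : \sum_k (delta_mx 0 l : 'rV[int]_n.+1) 0 k = 1.
  rewrite (bigD1 l) //= big1 => [|k /negPf kl]; first by rewrite mxE !eqxx.
  by rewrite mxE kl andbF.
apply/eqP; under eq_bigr do rewrite mxE [X in _ + X]mxE.
by rewrite sumrB !sd subrr.
Qed.

Definition root_diff i j : root := RootVec (root_diff_sum_zero i j).

Lemma root_diffE i j k : root_val (root_diff i j) 0 k = (k == i)%:R - (k == j)%:R.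
Proof. by rewrite !mxE !eqxx. Qed.

Lemma root_inj (a b : root) : (forall k, root_val a 0 k = root_val b 0 k) -> a = b.
Proof. by move=> ab; apply: val_inj; apply/rowP=> k; exact: ab. Qed.

Lemma root_diffD i j k : root_diff i j + root_diff j k = root_diff i k.
Proof.
by apply: root_inj => l; rewrite mxE !root_diffE addrA subrK.
Qed.

Lemma root_diff_act i j s : root_act (root_diff i j) s = root_diff (s i) (s j).
Proof.
apply: root_inj => k; rewrite root_diffE mxE root_diffE.
by rewrite !(canF_eq (permKV s)).
Qed.

Lemma coord_additive k : zmod_morphism (fun a : root => root_val a 0 k).
Proof. by move=> a b; rewrite !mxE. Qed.

Lemma coord_sum (I : finType) (F : I -> root) k :
  root_val (\sum_i F i) 0 k = \sum_i root_val (F i) 0 k.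
Proof. exact: (additive_sum _ (coord_additive k)). Qed.

Lemma coordM (a : root) z k : root_val (a *~ z) 0 k = root_val a 0 k *~ z.
Proof. exact: (additive_Mz (coord_additive k)). Qed.

Lemma sum_root (a : root) : \sum_i root_val a 0 i = 0.
Proof. exact/eqP/(valP a). Qed.

Lemma root_decomposition (a : root) o :
  a = \sum_i root_diff i o *~ root_val a 0 i.
Proof.
apply: root_inj => k; rewrite coord_sum.
transitivity (\sum_i (k == i)%:R * root_val a 0 i
    - \sum_i (k == o)%:R * root_val a 0 i).
  rewrite -mulr_sumr sum_root mulr0 subr0 (bigD1 k) //= eqxx mul1r big1 ?addr0 //.
  by move=> i ik; rewrite eq_sym (negPf ik) mul0r.
by rewrite -sumrB; apply: eq_bigr => i _; rewrite coordM root_diffE mulrzz; ring.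
Qed.

Lemma tensMl (a b : root) z : tens (a *~ z) b = tens a b *~ z.
Proof.
apply: (additive_Mz (f := fun u => tens u b)).
by apply: nmod_zmod_morphism => u v; rewrite tensDl.
Qed.

Lemma tensMr (a b : root) z : tens a (b *~ z) = tens a b *~ z.
Proof.
apply: (additive_Mz (f := fun u => tens a u)).
by apply: nmod_zmod_morphism => u v; rewrite tensDr.
Qed.

(** The arc from i to j stands for (e_i - e_j) (x) e_j, which lies in the
    tensor product of the root lattice with Z^n; over a circulation the second
    factors e_j may all be shifted by e_0, and then the sum lies in the tensor
    square. *)
Definition circ_tens (x : {ffun arcs -> int}) : square :=
  \sum_k tens (root_diff k.1 k.2) (root_diff k.2 ord0) *~ x k.

Lemma circ_tensB : zmod_morphism circ_tens.
Proof.
move=> x y; rewrite /circ_tens -sumrB; apply: eq_bigr => k _.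
by rewrite !ffunE mulrzBr.
Qed.

HB.instance Definition _ :=
  GRing.isZmodMorphism.Build _ _ circ_tens circ_tensB.

Lemma circ_root_sum (x : {ffun arcs -> int}) :
  boundary x = 0 -> \sum_k root_diff k.1 k.2 *~ x k = 0.
Proof.
move=> bx; apply: root_inj => l; rewrite coord_sum [RHS]mxE.
have /ffunP/(_ l) := bx; rewrite !ffunE => bl; rewrite -[RHS]oppr0 -[in RHS]bl.
rewrite sum_pairs /=.
transitivity (\sum_i (\sum_j (l == i)%:R * x (i, j)
    - \sum_j (l == j)%:R * x (i, j))).
  apply: eq_bigr => i _; rewrite -sumrB; apply: eq_bigr => j _.
  by rewrite coordM root_diffE mulrzz; ring.
rewrite sumrB opprB; congr (_ - _).
  rewrite (bigD1 l) //= [X in _ + X]big1 ?addr0 => [|i il].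
    by apply: eq_bigr => j _; rewrite eqxx mul1r.
  by rewrite big1 // => j _; rewrite eq_sym (negPf il) mul0r.
apply: eq_bigr => i _; rewrite (bigD1 l) //= eqxx mul1r big1 ?addr0 // => j jl.
by rewrite eq_sym (negPf jl) mul0r.
Qed.

Lemma circ_tens_base x o : boundary x = 0 ->
  circ_tens x = \sum_k tens (root_diff k.1 k.2) (root_diff k.2 o) *~ x k.
Proof.
move=> bx; apply/eqP; rewrite -subr_eq0 -sumrB; apply/eqP.
transitivity (tens (\sum_k root_diff k.1 k.2 *~ x k) (root_diff o ord0)).
  rewrite tens_suml; apply: eq_bigr => k _; rewrite -mulrzBl tensMl; congr (_ *~ _).
  by rewrite -(root_diffD k.2 o ord0) tensDr addrC addKr.
rewrite circ_root_sum //; apply: (@addrI _ (tens 0 (root_diff o ord0))).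
by rewrite -tensDl !addr0.
Qed.

(** Letting s act moves the base vertex of the second factors, which is harmless
    on circulations. *)
Lemma circ_tens_act x s : boundary x = 0 ->
  circ_tens (translate (arc_action 'P) s x) =
  tens_act (M := root_lattice n.+1) (N := root_lattice n.+1) (circ_tens x) s.
Proof.
move=> bx; have bxs : boundary (translate (arc_action 'P) s x) = 0.
  by rewrite boundary_translate bx raddf0.
rewrite (circ_tens_base (s ord0) bxs).
have actB := @tens_actB _ (root_lattice n.+1) (root_lattice n.+1) s.
rewrite /circ_tens (additive_sum _ actB).
rewrite (reindex_inj (act_inj (arc_action 'P) s)) /=.
apply: eq_bigr => -[i j] _ /=; rewrite (additive_Mz actB) tens_actE /=.
rewrite !root_diff_act; congr (_ *~ _).
exact: (translate_act (arc_action 'P) s x (i, j)).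
Qed.

Definition tens_matrix (m : square) : {ffun arcs -> int} :=
  [ffun k => tens_lift (fun a b : root => root_val a 0 k.1 * root_val b 0 k.2) m].

Lemma coord_biadditive k l :
  biadditive (fun a b : root => root_val a 0 k * root_val b 0 l).
Proof. by split=> *; rewrite !mxE; ring. Qed.

Lemma tens_matrixB : zmod_morphism tens_matrix.
Proof.
move=> x y; apply/ffunP=> k; rewrite !ffunE.
exact: (tens_liftB (coord_biadditive k.1 k.2)).
Qed.

HB.instance Definition _ :=
  GRing.isZmodMorphism.Build _ _ tens_matrix tens_matrixB.

Lemma tens_matrixE a b k :
  tens_matrix (tens a b) k = root_val a 0 k.1 * root_val b 0 k.2.
Proof. by rewrite ffunE (tens_liftE (coord_biadditive k.1 k.2)). Qed.

Lemma boundary_tens_matrix m : boundary (tens_matrix m) = 0.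
Proof.
apply: (tens_eq (f := fun m => boundary (tens_matrix m)) (g := fun=> 0)) m.
- by move=> x y; rewrite !raddfB.
- by move=> x y; rewrite subrr.
move=> a b; apply/ffunP=> k; rewrite !ffunE.
under eq_bigr do rewrite tens_matrixE /=; under [X in _ - X]eq_bigr do rewrite tens_matrixE /=.
by rewrite -mulr_suml -mulr_sumr !sum_root mulr0 mul0r subrr.
Qed.

(** Expand a (x) b on the pairs (e_i - e_0) (x) (e_j - e_0); the terms
    (e_j - e_0) (x) (e_j - e_0) by which circ_tens differs come with the factor
    sum_i a_i = 0. *)
Lemma tens_matrixK : cancel tens_matrix circ_tens.
Proof.
apply: (tens_eq (f := fun m => circ_tens (tens_matrix m)) (g := id)) => //.
  by move=> x y; rewrite !raddfB.
move=> a b; rewrite /circ_tens.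
transitivity (tens (\sum_i root_diff i ord0 *~ root_val a 0 i)
    (\sum_j root_diff j ord0 *~ root_val b 0 j)
  - \sum_j (tens (root_diff j ord0) (root_diff j ord0) *~ root_val b 0 j)
      *~ \sum_i root_val a 0 i); last first.
  by rewrite sum_root -!root_decomposition big1 ?subr0 // => j _; rewrite mulr0z.
rewrite sum_pairs /= tens_suml.
under [X in X - _]eq_bigr do rewrite tens_sumr.
under [X in _ - X]eq_bigr do rewrite mulrz_sumr.
rewrite [X in _ - X]exchange_big -sumrB; apply: eq_bigr => i _.
rewrite -sumrB; apply: eq_bigr => j _.
rewrite tens_matrixE tensMl tensMr -!mulrzA /=.
rewrite (_ : tens (root_diff i j) _ = tens (root_diff i ord0) (root_diff j ord0)
  - tens (root_diff j ord0) (root_diff j ord0)); last first.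
  by rewrite -(root_diffD i j ord0) tensDl addrK.
by rewrite mulrzBl; congr (_ *~ _ - _ *~ _); rewrite mulrC.
Qed.

Lemma circ_tens_off_diagonal x i j : boundary x = 0 -> i != j ->
  tens_matrix (circ_tens x) (i, j) = x (i, j).
Proof.
(* With i as base vertex, only the arc (i, j) contributes to the entry (i, j). *)
move=> bx ij; rewrite (circ_tens_base i bx) raddf_sum sum_ffunE.
have E k : (tens_matrix (tens (root_diff k.1 k.2) (root_diff k.2 i) *~ x k)) (i, j)
    = (k == (i, j))%:R * x k.
  rewrite raddfMz ffunMzE tens_matrixE !root_diffE /= mulrzz [j == i]eq_sym.
  case: k => k l /=; rewrite xpair_eqE (negPf ij) subr0 [k == i]eq_sym [l == j]eq_sym.
  by have [<-|_] := eqVneq j l; rewrite ?(negPf ij) /= ?subr0 ?andbT ?andbF ?mulr1 ?mulr0.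
rewrite (eq_bigr _ (fun k _ => E k)) (bigD1 (i, j)) //= eqxx mul1r big1 ?addr0 //.
by move=> k /negPf ->; rewrite mul0r.
Qed.

Lemma circ_tens_loops (x y : {ffun arcs -> int}) : (forall i j, i != j -> x (i, j) = y (i, j)) ->
  circ_tens x = circ_tens y.
Proof.
move=> xy; apply: eq_bigr => -[i j] _ /=; have [->|/xy -> //] := eqVneq i j.
suff -> : tens (root_diff j j) (root_diff j ord0) = 0 by rewrite !mul0rz.
apply: (@addrI _ (tens (root_diff j j) (root_diff j ord0))).
by rewrite -tensDl root_diffD addr0.
Qed.

End TensorSquare.

(** * From the tensor square to circulations *)

Section SumAction.
Variables (gT : finGroupType) (I J : finType).
Variables (toI : {action gT &-> I}) (toJ : {action gT &-> J}).

Definition sum_move (k : I + J) (g : gT) : I + J :=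
  match k with inl i => inl (toI i g) | inr j => inr (toJ j g) end.

Lemma sum_move1 : sum_move^~ 1%g =1 id.
Proof. by case=> i; rewrite /= act1. Qed.

Lemma sum_moveM k : act_morph sum_move k.
Proof. by move=> g h; case: k => i; rewrite /= actM. Qed.

Definition sum_action : {action gT &-> I + J} :=
  TotalAction sum_move1 sum_moveM.

End SumAction.

(** Adding the permutation lattice of loops to both terms of a resolution
    0 -> M -> P -> Q -> 0 of the tensor square M turns it into a resolution of
    the lattice of circulations. *)
Lemma quasi_permutation_root_square n :
    quasi_permutation
      (tensor_lattice (root_lattice n.+1) (root_lattice n.+1)) ->
  quasi_permutation_circulations (perm_action 'I_n.+1).
Proof.
move=> [P [Q [f [h [/permutation_lattice_coord[I [toI [c [c' [cK c'K cE]]]]]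
  /permutation_lattice_coord[J [toJ [d [d' [dK d'K dE]]]]] fE hE [fI fh hS]]]]]].
pose W : finType := 'I_n.+1.
pose F (x : {ffun W * W -> int}) : {ffun I + W -> int} :=
  [ffun k => match k with inl i => c (f (circ_tens x)) i | inr w => x (w, w) end].
pose left_part (y : {ffun I + W -> int}) : {ffun I -> int} := [ffun i => y (inl i)].
pose H (y : {ffun I + W -> int}) : {ffun J -> int} := d (h (c' (left_part y))).
have FB : zmod_morphism F.
  by move=> x y; apply/ffunP=> -[i|w]; rewrite !ffunE // !raddfB !ffunE.
have HM : zmod_morphism H.
  move=> x y; rewrite /H -!raddfB; congr (d (h (c' _))).
  by apply/ffunP=> i; rewrite !ffunE.
pose mF := GRing.isZmodMorphism.Build _ _ F FB.
pose mH := GRing.isZmodMorphism.Build _ _ H HM.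
pose F' : {additive {ffun W * W -> int} -> {ffun I + W -> int}} := HB.pack F mF.
pose H' : {additive {ffun I + W -> int} -> {ffun J -> int}} := HB.pack H mH.
have leftF x : left_part (F x) = c (f (circ_tens x)).
  by apply/ffunP=> i; rewrite !ffunE.
exists (I + W)%type, J, (sum_action toI (perm_action W)), toJ, F', H'; split.
- move=> g x bx; apply/ffunP=> -[i|w]; rewrite !ffunE /=; last by [].
  by rewrite circ_tens_act // -[tens_act _ _]/(@lat_act _ (tensor_lattice _ _) _ _) fE cE ffunE.
- move=> g y; rewrite /= /H -dE -hE; congr (d (h _)).
  rewrite -[RHS]cK cE c'K; congr (c' _).
  by apply/ffunP=> i; rewrite !ffunE.
- move=> x bx Fx.
  have cx : circ_tens x = 0.
    apply: fI; apply: (can_inj cK); rewrite !raddf0 -leftF -[F x]/(F' x) Fx.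
    by apply/ffunP=> i; rewrite !ffunE.
  apply/ffunP=> -[i j]; rewrite [RHS]ffunE; have [<-|ij] := eqVneq i j.
    by have /ffunP/(_ (inr i)) := Fx; rewrite !ffunE.
  by rewrite -(circ_tens_off_diagonal bx ij) cx raddf0 ffunE.
- move=> y; split=> [Hy|[x bx <-]]; last first.
    rewrite /= /H leftF cK.
    by rewrite (_ : h _ = 0) ?raddf0 //; apply/fh; exists (circ_tens x).
  have [m fm] : exists m, f m = c' (left_part y).
    by apply/fh; apply: (can_inj dK); rewrite raddf0.
  pose x : {ffun W * W -> int} := [ffun k =>
    if k.1 == k.2 then y (inr k.1) else tens_matrix m k].
  have xm : boundary x = 0.
    rewrite -(boundary_tens_matrix m); apply/ffunP=> k; rewrite !ffunE.
    rewrite (bigD1 k) //= [X in _ - X](bigD1 k) //=.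
    rewrite [X in _ = X - _](bigD1 k) //= [X in _ = _ - X](bigD1 k) //=.
    rewrite !opprD !(addrACA _ _ (- _)) !subrr !add0r.
    congr (_ - _); apply: eq_bigr => i ik; rewrite ffunE /= ?(negPf ik) //.
    by rewrite eq_sym (negPf ik).
  exists x => //; apply/ffunP=> -[i|w]; rewrite !ffunE /=; last by rewrite eqxx.
  have -> : circ_tens x = m.
    rewrite -[RHS]tens_matrixK; apply: circ_tens_loops => k l kl.
    by rewrite ffunE /= (negPf kl).
  by rewrite fm c'K ffunE.
- move=> z; have [p hp] := hS (d' z).
  exists [ffun k => if k is inl i then c p i else 0].
  rewrite /= /H -[RHS]d'K -hp; congr (d (h _)).
  by rewrite -[RHS]cK; congr (c' _); apply/ffunP=> i; rewrite !ffunE.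
Qed.

Lemma quasi_permutation_circulations_restrict (gT : finGroupType) (W : finType)
    (to : {action gT &-> W}) :
  quasi_permutation_circulations (perm_action 'I_#|W|) ->
  quasi_permutation_circulations to.
Proof.
move=> [I [J [toI [toJ [f [h [fE hE fI fh hS]]]]]]].
have rinj g : injective (fun i : 'I_#|W| => enum_rank (to (enum_val i) g)).
  by move=> i j /enum_rank_inj/act_inj/enum_val_inj.
pose r g : 'S_#|W| := perm (rinj g).
have rE g i : r g i = enum_rank (to (enum_val i) g) by rewrite permE.
have r1 : r 1%g = 1%g by apply/permP=> i; rewrite rE act1 enum_valK perm1.
have rM g k : r (g * k)%g = (r g * r k)%g.
  by apply/permP=> i; rewrite permM !rE enum_rankK actM.
have rV g : (r g)^-1%g = r g^-1%g.
  by apply: (mulgI (r g)); rewrite mulgV -rM mulgV r1.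
have I1 : (fun i g => toI i (r g))^~ 1%g =1 id by move=> i; rewrite r1 act1.
have IM i : act_morph (fun i g => toI i (r g)) i.
  by move=> g k; rewrite rM actM.
have J1 : (fun i g => toJ i (r g))^~ 1%g =1 id by move=> i; rewrite r1 act1.
have JM i : act_morph (fun i g => toJ i (r g)) i.
  by move=> g k; rewrite rM actM.
pose R (x : {ffun W * W -> int}) : {ffun 'I_#|W| * 'I_#|W| -> int} :=
  [ffun k => x (enum_val k.1, enum_val k.2)].
have RB : zmod_morphism R by move=> x y; apply/ffunP=> k; rewrite !ffunE.
have FB : zmod_morphism (f \o R) by move=> x y; rewrite /= RB raddfB.
pose mF := GRing.isZmodMorphism.Build _ _ (f \o R) FB.
pose F : {additive {ffun W * W -> int} -> {ffun I -> int}} := HB.pack (f \o R) mF.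
have bR x : boundary (R x) = [ffun i => boundary x (enum_val i)].
  apply/ffunP=> i; rewrite !ffunE; congr (_ - _).
    rewrite [RHS](reindex_onto enum_val enum_rank) /=; last by move=> j _; rewrite enum_rankK.
    by apply: eq_big => [j|j _]; rewrite ?enum_valK ?eqxx ?ffunE.
  rewrite [RHS](reindex_onto enum_val enum_rank) /=; last by move=> j _; rewrite enum_rankK.
  by apply: eq_big => [j|j _]; rewrite ?enum_valK ?eqxx ?ffunE.
have bR0 x : boundary x = 0 -> boundary (R x) = 0.
  by move=> bx; rewrite bR bx; apply/ffunP=> i; rewrite !ffunE.
have tR g x : R (translate (arc_action to) g x) =
    translate (arc_action (perm_action 'I_#|W|)) (r g) (R x).
  apply/ffunP=> -[i j]; rewrite !ffunE /=; congr (x (_, _)).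
    by rewrite rV -[aperm _ _]/(r _ _) rE enum_rankK.
  by rewrite rV -[aperm _ _]/(r _ _) rE enum_rankK.
exists I, J, (TotalAction I1 IM), (TotalAction J1 JM), F, h; split=> //.
- move=> g x bx; rewrite /= tR fE ?bR0 //.
  by apply/ffunP=> i; rewrite !ffunE /= rV.
- move=> g y; have -> : translate (TotalAction I1 IM) g y = translate toI (r g) y.
    by apply/ffunP=> i; rewrite !ffunE /= rV.
  by rewrite hE; apply/ffunP=> i; rewrite !ffunE /= rV.
- move=> x bx /(fI _ (bR0 _ bx)) Rx; apply/ffunP=> -[i j].
  have /ffunP/(_ (enum_rank i, enum_rank j)) := Rx.
  by rewrite !ffunE /= !enum_rankK.
move=> y; rewrite fh; split=> -[x bx <-]; last by exists (R x) => //; exact: bR0.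
pose x' : {ffun W * W -> int} := [ffun k => x (enum_rank k.1, enum_rank k.2)].
have xR : R x' = x by apply/ffunP=> -[i j]; rewrite !ffunE /= !enum_valK.
exists x'; last by rewrite /= xR.
apply/ffunP=> i; have := bR x'; rewrite xR bx => /ffunP/(_ (enum_rank i)).
by rewrite !ffunE enum_rankK => <-.
Qed.

(** * Locally trivial classes *)

Section Obstruction.
Variables (gT : finGroupType) (W I J : finType).
Variables (to : {action gT &-> W}) (toI : {action gT &-> I}).
Variables (toJ : {action gT &-> J}).
Variables (f : {additive {ffun W * W -> int} -> {ffun I -> int}}).
Variables (h : {additive {ffun I -> int} -> {ffun J -> int}}).
Hypothesis fh : circulation_sequence to toI toJ f h.

Local Notation tr := (translate (arc_action to)).

Lemma perm_circ_eq0 x : boundary x = 0 -> h (f x) = 0.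
Proof. by move=> bx; apply/(circ_exact fh); exists x. Qed.

Lemma boundary_diff_act g x :
  boundary (tr g x - x) = 0 <-> translate to g (boundary x) = boundary x.
Proof. by rewrite raddfB /= boundary_translate; split=> [/subr0_eq|->]; rewrite ?subrr. Qed.

(** The cocycle g |-> y g - y comes from a cocycle in the circulations, and the
    latter splits in the permutation lattice of all arcs. *)
Lemma circ_cocycle (G : {group gT}) y :
    (forall g, g \in G -> translate toJ g (h y) = h y) ->
  exists x, forall g, g \in G ->
    boundary (tr g x - x) = 0 /\ f (tr g x - x) = translate toI g y - y.
Proof.
move=> yG.
have /choice[m mP] : forall g, exists m, g \in G ->
    boundary m = 0 /\ f m = translate toI g y - y.
  move=> g; case: (boolP (g \in G)) => [gG|]; last by exists 0.
  have [m bm fm] : exists2 m, boundary m = 0 & f m = translate toI g y - y.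
    by apply/(circ_exact fh); rewrite raddfB /= (perm_equiv fh) yG ?subrr.
  by exists m.
have [g k gG kG|x xP] := @cocycle_coboundary _ _ (arc_action to) G m.
  have [bg fg] := mP g gG; have [bk fk] := mP k kG.
  have [bgk fgk] := mP (g * k)%g (groupM gG kG).
  have btr : boundary (tr k (m g)) = 0 by rewrite boundary_translate bg raddf0.
  apply/subr0_eq/(circ_inj fh).
    by rewrite raddfB raddfD /= bgk btr bk addr0 subrr.
  rewrite raddfB raddfD /= (circ_equiv fh) // fgk fg fk raddfB /= translateM.
  by rewrite addrA subrK subrr.
by exists x => g gG; rewrite -xP //; exact: mP.
Qed.

(** The cocycle g |-> w g - w has values in the circulations modulo p if the
    boundary of w is invariant modulo p, and it is integral if this boundary is
    truly invariant. The hypothesis says that its class is trivial on every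
    cyclic subgroup. Such a class vanishes in the middle term Z^I modulo p by
    cocycle_coboundary_mod, so it comes from an invariant of Z^J modulo p; as
    that invariant lifts, the class is integral. *)
Lemma invariant_boundary_lift (G : {group gT}) (p : nat) w : (0 < p)%N ->
    (forall g, g \in G ->
       exists y z, tr g y = y /\ boundary (w - y - z *+ p) = 0) ->
  exists z, forall g, g \in G ->
    translate to g (boundary (w - z *+ p)) = boundary (w - z *+ p).
Proof.
move=> p0 wG.
have /choice[yz yzP] : forall g, exists yz, g \in G ->
    tr g yz.1 = yz.1 /\ boundary (w - yz.1 - yz.2 *+ p) = 0.
  move=> g; case: (boolP (g \in G)) => [gG|]; last by exists (0, 0).
  by have [y [z yz]] := wG g gG; exists (y, z).
pose m g := w - (yz g).1 - (yz g).2 *+ p; pose mu g := tr g (m g) - m g.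
have bm g : g \in G -> boundary (m g) = 0 by move=> gG; have [] := yzP g gG.
have bmu g : g \in G -> boundary (mu g) = 0.
  by move=> gG; rewrite raddfB /= boundary_translate bm // raddf0 subrr.
pose e g := - (tr g (yz g).2 - (yz g).2).
have muE g : g \in G -> mu g = tr g w - w + e g *+ p.
  move=> gG; have [yg _] := yzP g gG.
  rewrite /mu /m !raddfB /= yg raddfMn /= mulNrn mulrnBl.
  by apply/ffunP=> k; rewrite !ffunE; ring.
have [g k gG kG|g i gG ig|c cP] := @cocycle_coboundary_mod _ _ toI G p (f \o mu).
- exists (f (e (g * k)%g - tr k (e g) - e k)).
  rewrite /= -(circ_equiv fh) ?bmu // -raddfMn -!(raddfD f); congr (f _).
  rewrite !muE ?groupM // translateM !(raddfD, raddfB, raddfMn) /=.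
  by apply/ffunP=> a; rewrite !(ffunE, ffunMnE); ring.
- have -> : (f \o mu) g i = 0; last by rewrite dvdz0.
  rewrite /= raddfB /= (circ_equiv fh) ?bm // !ffunE.
  by rewrite -{1}ig actK subrr.
have [g gG|q0 [z [q0G hc]]] := @invariant_lift _ _ toJ G p (h c).
  have [z zE] := cP g gG; exists (- h z); rewrite -(perm_equiv fh) -raddfB.
  have -> : translate toI g c - c = f (mu g) - z *+ p by rewrite [f _]zE addrK.
  by rewrite raddfB /= perm_circ_eq0 ?bmu // sub0r raddfMn mulNrn.
have [c' hc'] := perm_surj fh z; pose c1 := c - c' *+ p.
have hc1 : h c1 = q0 by rewrite raddfB raddfMn /= hc' hc addrK.
have [g gG|x xP] := @circ_cocycle G c1; first by rewrite hc1 q0G.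
have [g gG|w0 [u [w0G wx]]] := @invariant_lift _ _ (arc_action to) G p (w - x).
  have [bx fx] := xP g gG; have [z' zE] := cP g gG.
  have fE : f (mu g - (tr g x - x)) = (translate toI g c' - c' + z') *+ p.
    rewrite raddfB fx [f _]zE /c1 raddfB raddfMn /=.
    by apply/ffunP=> i; rewrite !(ffunE, ffunMnE); ring.
  have bE : boundary (mu g - (tr g x - x)) = 0 by rewrite raddfB /= bx bmu ?subrr.
  have [t bt ft] : exists2 t, boundary t = 0 & f t = translate toI g c' - c' + z'.
    apply/(circ_exact fh); apply: (ffun_mulrn_inj p0).
    by rewrite -raddfMn -fE perm_circ_eq0 // mul0rn.
  exists (t - e g).
  have muE' : mu g - (tr g x - x) = t *+ p.
    apply/subr0_eq/(circ_inj fh).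
      by rewrite raddfB raddfMn /= bE bt mul0rn subrr.
    by rewrite raddfB raddfMn /= ft fE subrr.
  rewrite mulrnBl -muE' muE // raddfB.
  by apply/ffunP=> a; rewrite !(ffunE, ffunMnE); ring.
exists u => g gG; have [/boundary_diff_act bx _] := xP g gG.
have -> : w - u *+ p = x + w0.
  have -> : w = w0 + u *+ p + x by rewrite -wx subrK.
  by apply/ffunP=> a; rewrite !(ffunE, ffunMnE); ring.
by rewrite !raddfD /= bx -boundary_translate w0G.
Qed.

End Obstruction.

(** * Composite degree *)

Section CompositeDegree.
Variable p : nat.
Hypothesis p_prime : prime p.

Local Notation plane := ('F_p * 'F_p)%type.

Lemma prime_mulz_neq1 (z : int) : z *+ p <> 1.
Proof.
move=> zp; have : (p %| z *+ p)%Z by rewrite -mulr_natr natz dvdz_mull.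
by rewrite zp dvdz1 absz_nat => /eqP p1; move: p_prime; rewrite p1.
Qed.

Section Rows.
Variable m : nat.
Hypothesis ltpm : (p < m)%N.

(** The m > p rows carry all p + 1 linear functionals of the plane up to
    scalars, so every element of the plane fixes some row pointwise. *)
Definition row_shift (j : 'I_m) (v : plane) : 'F_p :=
  if (j < p)%N then v.1 + j%:R * v.2 else v.2.

Lemma row_shiftD j u v : row_shift j (u * v)%g = row_shift j u + row_shift j v.
Proof. by rewrite /row_shift /=; case: ifP => // _; rewrite mulrDr addrACA. Qed.

Lemma row_shift0 j : row_shift j 1%g = 0.
Proof. by rewrite /row_shift /=; case: ifP => // _; rewrite mulr0 addr0. Qed.

Definition row_move (w : 'I_m * 'F_p) v := (w.1, w.2 + row_shift w.1 v).

Lemma row_move1 : row_move^~ 1%g =1 id.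
Proof. by case=> j i; rewrite /row_move row_shift0 addr0. Qed.

Lemma row_moveM w : act_morph row_move w.
Proof. by move=> u v; rewrite /row_move /= row_shiftD addrA. Qed.

Definition row_action : {action plane &-> 'I_m * 'F_p} :=
  TotalAction row_move1 row_moveM.

Lemma row_fixed v : exists j, row_shift j v = 0.
Proof.
case: v => a b; have [->|b0] := eqVneq b 0.
  by exists (Ordinal ltpm); rewrite /row_shift /= ltnn.
have [c cE] : exists c, a + c * b = 0 by exists (- a / b); rewrite divfK // addrN.
have lt := ltn_ord c; rewrite [X in (_ < X)%N]Fp_cast // in lt.
by exists (Ordinal (ltn_trans lt ltpm)); rewrite /row_shift /= lt natr_Zp.
Qed.

Lemma row_transitive j i : exists v, row_shift j v = i.
Proof.
rewrite /row_shift; case: (j < p)%N; last by exists (0, i).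
by exists (i, 0); rewrite /= mulr0 addr0.
Qed.

(** The boundary of the fan of arcs from (0,0) to row 0 is the sum of row 0 minus
    p times (0,0), which is invariant modulo p. If v fixes row j, replacing the
    apex by (j,0) gives a fan that v fixes, and the boundary changes by p times
    that of an arc. But truly invariant boundaries are constant on the
    rows, with total p times the sum of these constants; hence the constants
    have sum 0, while modulo p they are 1, 0, ..., 0. *)
Lemma rows_not_quasi_permutation :
  ~ quasi_permutation_circulations row_action.
Proof.
move=> [I [J [toI [toJ [f [h fh]]]]]].
pose o : 'I_m := Ordinal (ltn_trans (prime_gt0 p_prime) ltpm).
pose fan j : {ffun ('I_m * 'F_p) * ('I_m * 'F_p) -> int} :=
  \sum_i unit_fun ((j, 0), (o, i)).
have fanE j : boundary (fan j) = \sum_i unit_fun (o, i) - unit_fun (j, 0) *+ p.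
  rewrite raddf_sum /=; under eq_bigr do rewrite boundary_arc.
  by rewrite sumrB sumr_const card_Fp.
have [v _|z zP] :=
    @invariant_boundary_lift _ _ _ _ _ _ _ _ _ fh [set: plane]%G p (fan o)
      (prime_gt0 p_prime).
  have [j jv] := row_fixed v; exists (fan j), (unit_fun ((o, 0), (j, 0))); split.
    rewrite raddf_sum /= [RHS](reindex_inj (addIr (row_shift o v))) /=.
    apply: eq_bigr => i _; rewrite translate_unit; congr unit_fun.
    by rewrite /= /arc_move /= /row_move /= jv addr0.
  rewrite !raddfB raddfMn /= !fanE boundary_arc.
  by apply/ffunP=> k; rewrite !(ffunE, ffunMnE); ring.
pose a := boundary (fan o - z *+ p).
have aE j i : a (j, i) = a (j, 1).
  have [v vE] := row_transitive j (i - 1).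
  have av : translate row_action v a = a by apply: zP; rewrite inE.
  rewrite -{1}av.
  have -> : (j, i) = row_action (j, 1) v by rewrite /= /row_move /= vE addrC subrK.
  by rewrite translate_act.
have sa : \sum_j a (j, 1) = 0.
  apply: (pmulrnI (prime_gt0 p_prime)); rewrite mul0rn -sumrMnl.
  rewrite -[RHS](sum_boundary (fan o - z *+ p)) -/a sum_pairs.
  apply: eq_bigr => j _; rewrite (eq_bigr _ (fun i _ => aE j i)) sumr_const.
  by rewrite card_Fp.
apply: (@prime_mulz_neq1 (\sum_j boundary z (j, 1))).
apply/esym/subr0_eq; rewrite -[RHS]sa -sumrMnl.
transitivity (\sum_j (j == o)%:R - \sum_j boundary z (j, 1) *+ p).
  congr (_ - _); rewrite [RHS](bigD1 o) //= big1 ?addr0 ?eqxx //.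
  by move=> j /negPf ->.
rewrite -sumrB.
have -> : a = boundary (fan o) - boundary z *+ p by rewrite /a raddfB raddfMn.
apply: eq_bigr => j _; rewrite fanE; move: (boundary z) => bz.
rewrite !(ffunE, ffunMnE); congr (_ - _).
rewrite sum_ffunE (bigD1 1) //= big1 => [|i i1].
  rewrite !ffunE !xpair_eqE eqxx oner_eq0 andbT andbF.
  by rewrite mul0rn addr0 subr0.
by rewrite ffunE xpair_eqE [1 == i]eq_sym (negPf i1) andbF.
Qed.

End Rows.

Definition plane_move (w v : plane) : plane := w + v.

Lemma plane_move1 : plane_move^~ 1%g =1 id.
Proof. by move=> w; rewrite /plane_move addr0. Qed.

Lemma plane_moveM w : act_morph plane_move w.
Proof. by move=> u v; rewrite /plane_move addrA. Qed.

Definition plane_action : {action plane &-> plane} :=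
  TotalAction plane_move1 plane_moveM.

Definition pcomb (v u : plane) (k : plane) : plane :=
  (k.1 * v.1 + k.2 * u.1, k.1 * v.2 + k.2 * u.2).

Lemma pcomb_step v u k l : pcomb v u (k, l) + v = pcomb v u (k + 1, l).
Proof.
transitivity (k * v.1 + l * u.1 + v.1, k * v.2 + l * u.2 + v.2); first by [].
by congr (_, _); rewrite /=; ring.
Qed.

Lemma plane_basis (v : plane) : v != 0 -> exists u, injective (pcomb v u).
Proof.
case: v => a b; rewrite -pair_eqE /= => ab.
suff [c [d det]] : exists c d, a * d - b * c != 0.
  exists (c, d) => -[k l] [k' l'] kl.
  have e1 : k * a + l * c = k' * a + l' * c := congr1 fst kl.
  have e2 : k * b + l * d = k' * b + l' * d := congr1 snd kl.
  have ek : (k - k') * (a * d - b * c) = 0.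
    transitivity (d * (k * a + l * c - (k' * a + l' * c))
      - c * (k * b + l * d - (k' * b + l' * d))); first by ring.
    by rewrite e1 e2 !subrr !mulr0 subrr.
  have el : (l - l') * (a * d - b * c) = 0.
    transitivity (a * (k * b + l * d - (k' * b + l' * d))
      - b * (k * a + l * c - (k' * a + l' * c))); first by ring.
    by rewrite e1 e2 !subrr !mulr0 subrr.
  move/eqP: ek; rewrite mulf_eq0 (negPf det) orbF subr_eq0 => /eqP ->.
  by move/eqP: el; rewrite mulf_eq0 (negPf det) orbF subr_eq0 => /eqP ->.
move: ab; rewrite negb_and => /orP[a0|b0].
  by exists 0, 1; rewrite mulr1 mulr0 subr0.
by exists (-1), 0; rewrite mulr0 mulrN1 sub0r opprK.
Qed.

(** The fan of arcs from 0 to the plane has as boundary the sum of all points minus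
    p^2 times 0. For v != 0 the line of v replaces the apex: each point of the
    line sends arcs to its translates by the multiples of u. This is
    invariant under v, and the boundary changes by p times that of the fan from
    0 to the line. An invariant boundary is constant, hence 0, whereas the
    boundary of the fan is 1 modulo p away from 0. *)
Lemma plane_not_quasi_permutation :
  ~ quasi_permutation_circulations plane_action.
Proof.
move=> [I [J [toI [toJ [f [h fh]]]]]].
pose fan : {ffun plane * plane -> int} := \sum_(w : plane) unit_fun ((0, w) : plane * plane).
have card_plane : #|{: plane}| = (p * p)%N by rewrite card_prod card_Fp.
have fanE : boundary fan = \sum_(w : plane) unit_fun w - unit_fun (0 : plane) *+ (p * p).
  rewrite raddf_sum /=; under eq_bigr do rewrite boundary_arc.
  by rewrite sumrB sumr_const card_plane.
have [v _|z zP] :=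
    @invariant_boundary_lift _ _ _ _ _ _ _ _ _ fh [set: plane]%G p fan
      (prime_gt0 p_prime).
  have [->|v0] := eqVneq v 0.
    by exists fan, 0; rewrite translate1 mul0rn subr0 subrr raddf0.
  have [u uI] := plane_basis v0; pose line k := pcomb v u (k, 0).
  exists (\sum_k \sum_l unit_fun (line k, pcomb v u (k, l))).
  exists (\sum_k unit_fun ((0, line k) : plane * plane)); split.
    rewrite raddf_sum /= [RHS](reindex_inj (addIr 1)) /=.
    apply: eq_bigr => k _; rewrite raddf_sum; apply: eq_bigr => l _ /=.
    rewrite translate_unit; congr unit_fun.
    by rewrite /= /arc_move /= /plane_move /line !pcomb_step.
  have bE : boundary (\sum_k \sum_l unit_fun (line k, pcomb v u (k, l))) =
      \sum_(w : plane) unit_fun w - (\sum_k unit_fun (line k)) *+ p.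
    rewrite [X in _ = X - _](reindex_inj uI) sum_pairs -sumrMnl -sumrB raddf_sum.
    apply: eq_bigr => k _; rewrite raddf_sum /=.
    by under eq_bigr do rewrite boundary_arc; rewrite sumrB sumr_const card_Fp.
  have lineE : boundary (\sum_k unit_fun ((0, line k) : plane * plane)) =
      \sum_k unit_fun (line k) - unit_fun (0 : plane) *+ p.
    rewrite raddf_sum /=; under eq_bigr do rewrite boundary_arc.
    by rewrite sumrB sumr_const card_Fp.
  rewrite !raddfB raddfMn /= fanE bE lineE mulrnBl mulrnA.
  by apply/ffunP=> k; rewrite !(ffunE, ffunMnE); ring.
pose a := boundary (fan - z *+ p).
have aE w : a w = a (1, 0).
  have av : translate plane_action (w - (1, 0)) a = a by apply: zP; rewrite inE.
  rewrite -{1}av.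
  have wE : w = plane_action (1, 0) (w - (1, 0)).
    by rewrite /= /plane_move addrC subrK.
  by rewrite [X in translate _ _ _ X]wE translate_act.
have a0 : a (1, 0) = 0.
  have pp : (0 < p * p)%N by rewrite muln_gt0 prime_gt0.
  apply: (pmulrnI pp); rewrite mul0rn -[RHS](sum_boundary (fan - z *+ p)) -/a.
  by rewrite (eq_bigr _ (fun w _ => aE w)) sumr_const card_plane.
apply: (@prime_mulz_neq1 (boundary z (1, 0))).
have aE' : a = boundary fan - boundary z *+ p by rewrite /a raddfB raddfMn.
move: a0; rewrite aE' fanE; move: (boundary z) => bz; rewrite !(ffunE, ffunMnE).
rewrite sum_ffunE (bigD1 (1, 0)) //= big1 => [|w w1]; last first.
  by rewrite ffunE eq_sym (negPf w1).
by rewrite ffunE eqxx mul0rn addr0 subr0 => /subr0_eq/esym.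
Qed.

End CompositeDegree.

Lemma composite_not_quasi_permutation n : (1 < n)%N -> ~~ prime n ->
  ~ quasi_permutation (tensor_lattice (root_lattice n) (root_lattice n)).
Proof.
move=> n1 nP qp; pose p := pdiv n; pose m := (n %/ p)%N.
have pP : prime p := pdiv_prime n1.
have nE : n = (m * p)%N by rewrite divnK // pdiv_dvd.
have lepm : (p <= m)%N.
  apply: pdiv_min_dvd; last by rewrite nE dvdn_mulr.
  rewrite ltn_neqAle; apply/andP; split; last first.
    by move: n1; rewrite nE; case: (m).
  by apply: contra nP => /eqP m1; rewrite nE -m1 mul1n.
move: lepm; rewrite leq_eqVlt => /orP[/eqP pm|ltpm].
  have nW : n = #|{: 'F_p * 'F_p}|.
    by rewrite card_prod card_Fp // {1}nE -pm.
  apply: (@plane_not_quasi_permutation p pP).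
  apply: quasi_permutation_circulations_restrict; rewrite -nW.
  by case: (n) n1 qp => // k _; exact: quasi_permutation_root_square.
have nW : n = #|{: 'I_m * 'F_p}|.
  by rewrite card_prod card_Fp // card_ord.
apply: (@rows_not_quasi_permutation p pP m ltpm).
apply: quasi_permutation_circulations_restrict; rewrite -nW.
by case: (n) n1 qp => // k _; exact: quasi_permutation_root_square.
Qed.

(** * Degree-zero Tate cohomology over a group of prime order *)

Section PrimeCyclic.
Variables (gT : finGroupType) (s : gT).
Hypothesis s_prime : prime #[s]%g.

Section OnePermutationModule.
Variables (I : finType) (to : {action gT &-> I}).

Lemma cycle_fixed i : to i s = i -> forall g, g \in <[s]>%g -> to i g = i.
Proof.
move=> si g /cycleP[k ->]; elim: k => [|k IH]; first by rewrite act1.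
by rewrite expgSr actM IH.
Qed.

Lemma unit_fun_invariant i : to i s = i ->
  forall g, g \in <[s]>%g -> translate to g (unit_fun i) = unit_fun i.
Proof. by move=> si g gs; rewrite translate_unit cycle_fixed. Qed.

(** The stabiliser of a point is the whole group, of order p, or trivial. So the
    fixed points form an F_p-basis of the degree-zero Tate cohomology. *)
Lemma invariant_norm_prime x :
    (forall g, g \in <[s]>%g -> translate to g x = x) ->
    (forall i, to i s = i -> (#[s]%g %| x i)%Z) ->
  exists y, x = norm to <[s]> y.
Proof.
move=> xs xd; apply: invariant_norm => // i.
have [si|nsi] := eqVneq (to i s) i.
  apply: dvdz_trans (xd i si); rewrite /dvdz !absz_nat.
  by apply: cardSg; exact: subsetIl.
suff -> : 'C_(<[s]>)[i | to]%g = 1%g by rewrite cards1 dvd1z.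
apply/eqP; apply: contraNT nsi => st; apply/eqP.
have /subsetP/(_ s (cycle_id s)) := prime_meetG s_prime st.
by rewrite !inE sub1set inE => /eqP.
Qed.

Lemma norm_translate g x : g \in <[s]>%g ->
  norm to <[s]> (translate to g x) = norm to <[s]> x.
Proof.
move=> gs; rewrite /norm [RHS](reindex_inj (mulgI g)) /=.
by apply: eq_big => [k|k _]; rewrite ?groupMl // translateM.
Qed.

Lemma translate_norm_normaliser t x : t \in 'N(<[s]>)%g ->
  translate to t (norm to <[s]> x) = norm to <[s]> (translate to t x).
Proof.
move=> tN; rewrite /norm raddf_sum /= [RHS](reindex_inj (conjg_inj t)) /=.
apply: eq_big => [k|k _]; last by rewrite -!translateM conjgE !mulgA mulgV mul1g.
by rewrite memJ_norm.
Qed.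

Lemma fixed_normaliser t x : t \in 'N(<[s]>)%g ->
  (to (to x t) s == to x t) = (to x s == x).
Proof.
move=> tN; have tsV : (t * s * t^-1)%g \in <[s]>%g.
  by rewrite -{1}(invgK t) -mulgA -conjgE memJ_norm ?groupV ?cycle_id.
have st : (s ^ t)%g \in <[s]>%g by rewrite memJ_norm ?cycle_id.
apply/eqP/eqP => xs; last first.
  have := cycle_fixed xs tsV; rewrite !actM => /(congr1 (fun x => to x t)).
  by rewrite actKV.
have := cycle_fixed xs st; rewrite conjgE !actM actK => e.
exact: (act_inj to t).
Qed.

End OnePermutationModule.

Variables (W I J : finType).
Variables (to : {action gT &-> W}) (toI : {action gT &-> I}).
Variables (toJ : {action gT &-> J}).
Variables (f : {additive {ffun W * W -> int} -> {ffun I -> int}}).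
Variables (h : {additive {ffun I -> int} -> {ffun J -> int}}).
Hypothesis fh : circulation_sequence to toI toJ f h.
Hypothesis s_transitive : forall i j, exists2 g, g \in <[s]>%g & to i g = j.

Local Notation tr := (translate (arc_action to)).
Local Notation N := (norm (arc_action to) <[s]>).
Local Notation NI := (norm toI <[s]>).
Local Notation NJ := (norm toJ <[s]>).
Local Notation p := #[s]%g.
Local Notation invariant toX x :=
  (forall g, g \in <[s]>%g -> translate toX g x = x).

Lemma circ_norm x : boundary x = 0 -> f (N x) = NI (f x).
Proof.
move=> bx; rewrite raddf_sum; apply: eq_bigr => g _.
exact: (circ_equiv fh).
Qed.

Lemma perm_norm y : h (NI y) = NJ (h y).
Proof. by rewrite raddf_sum; apply: eq_bigr => g _; exact: (perm_equiv fh). Qed.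

Lemma boundary_norm x : boundary x = 0 -> boundary (N x) = 0.
Proof.
move=> bx; rewrite raddf_sum big1 // => g _ /=.
by rewrite boundary_translate bx raddf0.
Qed.

(** The first cohomology of the circulations vanishes: a function on arcs whose
    boundary is invariant under a transitive group is a circulation, as its
    boundary is constant and has sum zero. *)
Lemma lift_invariant z : invariant toJ z -> exists2 y, invariant toI y & h y = z.
Proof.
move=> zs; have [y hy] := perm_surj fh z.
have [|x xP] := @circ_cocycle _ _ _ _ _ _ _ _ _ fh <[s]>%G y.
  by rewrite hy.
have bxs g : g \in <[s]>%g -> translate to g (boundary x) = boundary x.
  by move=> gs; apply/boundary_diff_act; have [] := xP g gs.
have bx : boundary x = 0.
  apply/ffunP=> i; rewrite [RHS]ffunE.
  have b1 j : boundary x j = boundary x i.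
    by have [g gs <-] := s_transitive i j; rewrite -{1}(bxs g gs) translate_act.
  have := sum_boundary x; rewrite (eq_bigr _ (fun j _ => b1 j)) sumr_const.
  have W0 : (0 < #|W|)%N by apply/card_gt0P; exists i.
  by move=> e; apply: (pmulrnI W0); rewrite e mul0rn.
exists (y - f x); last by rewrite raddfB /= hy (perm_circ_eq0 fh) ?subr0.
move=> g gs; have [_ e] := xP g gs; apply/subr0_eq; rewrite raddfB /=.
have <- : f (tr g x) = translate toI g (f x) by exact: (circ_equiv fh).
rewrite raddfB in e.
transitivity (translate toI g y - y - (f (tr g x) - f x)).
  by apply/ffunP=> k; rewrite !ffunE; ring.
by rewrite e subrr.
Qed.

Variable m0 : {ffun W * W -> int}.
Hypothesis m0_circ : boundary m0 = 0.
Hypothesis m0_invariant : invariant (arc_action to) m0.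
Hypothesis m0_generates : forall m, boundary m = 0 ->
  invariant (arc_action to) m ->
  exists (a : int) m', boundary m' = 0 /\ m = m0 *~ a + N m'.
Hypothesis m0_not_norm : forall m, boundary m = 0 -> m0 <> N m.

Lemma pchar_s : p \in [pchar 'F_p].
Proof. exact: pchar_Fp. Qed.

Lemma intr_dvd (z : int) : (p %| z)%Z = (z%:~R == 0 :> 'F_p).
Proof. exact: dvdz_pcharf pchar_s z. Qed.

Definition mod_p (z : int) : 'F_p := z%:~R.

Lemma mod_p_norm (X : finType) (toX : {action gT &-> X}) y i : toX i s = i ->
  mod_p (norm toX <[s]> y i) = 0.
Proof.
move=> si; rewrite norm_fixed; last exact: cycle_fixed si.
by apply/eqP; rewrite -intr_dvd -orderE -mulr_natr natz dvdz_mull.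
Qed.

(** The matrix of the map F_p^X -> F_p^Y induced by h on the degree-zero Tate
    cohomology, and the image in F_p^X of the generator. *)
Definition fixed_coef (x : I) (y : J) : 'F_p := mod_p (h (unit_fun x) y).
Definition fixed_gen (x : I) : 'F_p := mod_p (f m0 x).

Lemma mod_p_sum (X : finType) (P : pred X) (F : X -> int) :
  mod_p (\sum_(i | P i) F i) = \sum_(i | P i) mod_p (F i).
Proof. exact: raddf_sum. Qed.

Lemma mod_pM a b : mod_p (a * b) = mod_p a * mod_p b.
Proof. exact: rmorphM. Qed.

Lemma mod_pD a b : mod_p (a + b) = mod_p a + mod_p b.
Proof. exact: rmorphD. Qed.

Lemma mod_pB a b : mod_p (a - b) = mod_p a - mod_p b.
Proof. exact: rmorphB. Qed.

Lemma invariantB (X : finType) (toX : {action gT &-> X}) x y :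
  invariant toX x -> invariant toX y -> invariant toX (x - y).
Proof. by move=> xs ys g gs; rewrite raddfB /= xs ?ys. Qed.

Lemma invariant_sumM (X Y : finType) (toX : {action gT &-> X})
    (P : pred Y) (F : Y -> {ffun X -> int}) (c : Y -> int) :
  (forall i, P i -> invariant toX (F i)) ->
  invariant toX (\sum_(i | P i) F i *~ c i).
Proof.
move=> Fs g gs; rewrite raddf_sum; apply: eq_bigr => i Pi.
by rewrite raddfMz /= Fs.
Qed.

Lemma sum_unitM (X : finType) (P : pred X) (c : X -> int) j :
  (\sum_(i | P i) unit_fun i *~ c i) j = if P j then c j else 0.
Proof.
rewrite sum_ffunE; case: ifP => Pj.
  rewrite (bigD1 j) //= ffunMzE ffunE eqxx intz big1 ?addr0 // => i /andP[_ ij].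
  by rewrite ffunMzE ffunE eq_sym (negPf ij) mul0rz.
rewrite big1 // => i Pi; rewrite ffunMzE ffunE.
by case: eqP => [ji|]; rewrite ?mul0rz // ji Pi in Pj *.
Qed.

Lemma fixed_coefE w y : invariant toI w -> toJ y s = y ->
  mod_p (h w y) = \sum_(x | toI x s == x) fixed_coef x y * mod_p (w x).
Proof.
move=> ws ys; pose w0 := \sum_(x | toI x s == x) unit_fun x *~ w x.
have [| |u wu] := @invariant_norm_prime _ toI (w - w0).
- apply: invariantB => //; apply: invariant_sumM => i /eqP.
  exact: unit_fun_invariant.
- by move=> i si; rewrite !ffunE sum_unitM si eqxx subrr dvdz0.
have hw : h w y = NJ (h u) y + \sum_(x | toI x s == x) h (unit_fun x) y * w x.
  have -> : h w = NJ (h u) + h w0 by rewrite -perm_norm -wu -raddfD subrK.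
  rewrite ffunE; congr (_ + _); rewrite raddf_sum sum_ffunE.
  by apply: eq_bigr => x _; rewrite raddfMz ffunMzE mulrzz.
rewrite hw mod_pD mod_p_norm // add0r mod_p_sum.
by apply: eq_bigr => x _; rewrite mod_pM.
Qed.

Lemma unit_lifts : exists l : J -> {ffun I -> int},
  forall y, toJ y s = y -> invariant toI (l y) /\ h (l y) = unit_fun y.
Proof.
suff /choice[l lP] : forall y, exists w, toJ y s = y ->
    invariant toI w /\ h w = unit_fun y by exists l.
move=> y; have [ys|ys] := eqVneq (toJ y s) y; last by exists 0 => /eqP; rewrite (negPf ys).
have [w ws hw] := lift_invariant (unit_fun_invariant ys).
by exists w.
Qed.

(** Exactness in the middle of 0 -> F_p -> F_p^X -> F_p^Y: if h w is a norm, then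
    w is the sum of a norm and of an invariant circulation, which is a multiple
    of m0 up to norms. *)
Lemma fixed_kernel w : invariant toI w ->
    (forall y, toJ y s = y -> (p %| h w y)%Z) ->
  exists r, forall x, toI x s = x -> mod_p (w x) = r * fixed_gen x.
Proof.
move=> ws hwd; have hws : invariant toJ (h w).
  by move=> g gs; rewrite -(perm_equiv fh) ws.
have [q hq] := invariant_norm_prime hws hwd.
have [w' hw'] := perm_surj fh q.
have [m bm fm] : exists2 m, boundary m = 0 & f m = w - NI w'.
  by apply/(circ_exact fh); rewrite raddfB /= perm_norm hw' hq subrr.
have ms : invariant (arc_action to) m.
  move=> g gs; apply/subr0_eq/(circ_inj fh).
    by rewrite raddfB /= boundary_translate bm raddf0 subrr.
  by rewrite raddfB /= (circ_equiv fh) // fm raddfB /= ws // translate_norm ?subrr.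
have [a [m' [bm' mE]]] := m0_generates bm ms.
exists (mod_p a) => x xs.
have -> : w = f m0 *~ a + NI (f m') + NI w'.
  by rewrite -circ_norm // -raddfMz -raddfD -mE fm subrK.
rewrite !ffunE ffunMzE !mod_pD !mod_p_norm // !addr0.
by rewrite mulrzz mod_pM mulrC.
Qed.

(** If the image of m0 is a norm of w, then h w has norm zero, hence is of the
    form q s - q; correcting w by a lift of q makes it a circulation with norm
    m0. *)
Lemma fixed_gen_neq0 : exists2 x, toI x s = x & fixed_gen x != 0.
Proof.
apply: contrapT => nx.
have fs : invariant toI (f m0).
  by move=> g gs; rewrite -(circ_equiv fh) // m0_invariant.
have [x xs|w fw] := invariant_norm_prime fs.
  by rewrite intr_dvd; apply/negPn/negP => xn; apply: nx; exists x.
have [q hq] : exists q, h w = translate toJ s q - q.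
  by apply: norm_eq0; rewrite -perm_norm -fw (perm_circ_eq0 fh).
have [w' hw'] := perm_surj fh q.
have [m bm fm] : exists2 m, boundary m = 0 & f m = w - (translate toI s w' - w').
  by apply/(circ_exact fh); rewrite !(raddfB h) (perm_equiv fh) hw' hq subrr.
apply: (m0_not_norm bm); apply/subr0_eq/(circ_inj fh).
  by rewrite raddfB /= m0_circ boundary_norm // subrr.
rewrite raddfB /= circ_norm // fm !(raddfB NI) /= norm_translate ?cycle_id //.
by rewrite -fw subrr subr0 subrr.
Qed.

(** Write X and Y for the fixed basis elements of the two permutation lattices.
    Tate cohomology gives an exact sequence 0 -> F_p -> F_p^X -> F_p^Y -> 0,
    whose left term is spanned by the class of m0. The hypothesis says that the
    inverse of t multiplies this class by a, so a is the difference of the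
    traces of this inverse on the other two terms. These traces count fixed
    points. *)
Lemma fixed_point_trace t (a : 'F_p) : t \in 'N(<[s]>)%g ->
    (forall x, toI x s = x -> fixed_gen (toI x t) = a * fixed_gen x) ->
  \sum_(x | toI x s == x) (toI x t == x)%:R =
  \sum_(y | toJ y s == y) (toJ y t == y)%:R + a :> 'F_p.
Proof.
move=> tN ta; have [l lP] := unit_lifts.
(* The lifts l give a section of F_p^X -> F_p^Y, and r the complementary
   projection onto the line; the identity of F_p^X is the sum of the two
   resulting projectors. *)
have fixt (X : finType) (toX : {action gT &-> X}) x :
    (toX (toX x t) s == toX x t) = (toX x s == x) by exact: fixed_normaliser.
have /choice[r rP] : forall x, exists r, toI x s = x -> forall x', toI x' s = x' ->
    (x' == x)%:R = \sum_(y | toJ y s == y) fixed_coef x y * mod_p (l y x')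
      + r * fixed_gen x' :> 'F_p.
  move=> x; have [xs|xs] := eqVneq (toI x s) x; last by exists 0 => /eqP; rewrite (negPf xs).
  pose w := unit_fun x - \sum_(y | toJ y s == y) l y *~ h (unit_fun x) y.
  have ws : invariant toI w.
    apply: invariantB; first exact: unit_fun_invariant.
    by apply: invariant_sumM => y /eqP/lP[].
  have [y ys|r rP] := fixed_kernel ws.
    rewrite raddfB raddf_sum /= ffunE [X in _ + X]ffunE.
    rewrite (eq_bigr (fun y => unit_fun y *~ h (unit_fun x) y)); last first.
      by move=> z /eqP/lP[_ hz]; rewrite raddfMz /= hz.
    by rewrite sum_unitM ys eqxx subrr dvdz0.
  exists r => _ x' x's; rewrite -rP //.
  rewrite (_ : mod_p (w x') = (x' == x)%:R
    - \sum_(y | toJ y s == y) fixed_coef x y * mod_p (l y x')).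
    by rewrite addrC subrK.
  rewrite ffunE [X in _ + X]ffunE ffunE mod_pB sum_ffunE mod_p_sum.
  congr (_ - _); first exact: rmorph_nat.
  by apply: eq_bigr => y _; rewrite ffunMzE mulrzz mod_pM mulrC.
have rv : \sum_(x | toI x s == x) r x * fixed_gen x = 1.
  have [x0 x0s v0] := fixed_gen_neq0; apply: (mulIf v0); rewrite mul1r mulr_suml.
  transitivity (\sum_(x | toI x s == x) (fixed_gen x * (x0 == x)%:R -
      \sum_(y | toJ y s == y) fixed_coef x y * fixed_gen x * mod_p (l y x0))).
    apply: eq_bigr => x /eqP xs; rewrite (rP x xs x0 x0s) mulrDr mulr_sumr.
    rewrite [X in X + _ - _](eq_bigr
      (fun y => fixed_coef x y * fixed_gen x * mod_p (l y x0))).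
      by rewrite addrC addKr mulrCA mulrA.
    by move=> y _; rewrite mulrCA mulrA.
  rewrite sumrB [X in _ - X]exchange_big [X in _ - X]big1 ?subr0 => [|y /eqP ys].
    rewrite (bigD1 x0) ?x0s //= eqxx mulr1 big1 ?addr0 // => x /andP[_ xx0].
    by rewrite eq_sym (negPf xx0) mulr0.
  rewrite -mulr_suml -fixed_coefE //.
    by rewrite (perm_circ_eq0 fh) // ffunE /mod_p mulr0z mul0r.
  by move=> g gs; rewrite -(circ_equiv fh) // m0_invariant.
have coef_t x y : fixed_coef (toI x t) (toJ y t) = fixed_coef x y.
  by rewrite /fixed_coef -translate_unit (perm_equiv fh) translate_act.
transitivity (\sum_(x | toI x s == x) (\sum_(y | toJ y s == y)
    fixed_coef x y * mod_p (l y (toI x t)) + a * (r x * fixed_gen x))).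
  apply: eq_bigr => x /eqP xs; rewrite (rP x xs); last by apply/eqP; rewrite fixt xs.
  by rewrite ta // mulrCA.
rewrite big_split /= -mulr_sumr rv mulr1; congr (_ + _); rewrite exchange_big /=.
apply: eq_bigr => y /eqP ys; have [ly hl] := lP y ys.
transitivity (\sum_(x | toI x s == x) fixed_coef x (toJ y t) * mod_p (l y x)).
  rewrite [RHS](reindex_inj (act_inj toI t)) /=.
  by apply: eq_big => [x|x _]; rewrite ?fixt ?coef_t.
rewrite -fixed_coefE //; last by apply/eqP; rewrite fixt ys.
by rewrite hl ffunE; exact: rmorph_nat.
Qed.

End PrimeCyclic.

(** * Prime degree *)

Section PrimeDegree.
Variable p : nat.
Hypothesis p_prime : prime p.

Definition shift (i : 'F_p) : {perm 'F_p} := perm (addIr i).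

Lemma shiftE i x : shift i x = x + i.
Proof. by rewrite permE. Qed.

Lemma shiftD i j : shift (i + j) = (shift i * shift j)%g.
Proof. by apply/permP=> x; rewrite permM !shiftE addrA. Qed.

Lemma shiftV i : (shift i)^-1%g = shift (- i).
Proof.
apply/(mulgI (shift i)); rewrite mulgV -shiftD subrr.
by apply/permP=> x; rewrite shiftE addr0 perm1.
Qed.

Lemma shift_inj : injective shift.
Proof.
by move=> i j /permP/(_ 0); rewrite !shiftE !add0r.
Qed.

Local Notation s := (shift 1).

Lemma shiftX k : (s ^+ k)%g = shift k%:R.
Proof.
elim: k => [|k IH]; last by rewrite expgSr IH -shiftD -natr1.
by apply/permP=> x; rewrite shiftE addr0 perm1.
Qed.

Lemma cycle_shift : <[s]>%g = [set shift i | i : 'F_p] :> {set _}.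
Proof.
apply/setP=> g; apply/cycleP/imsetP=> [[k ->]|[i _ ->]].
  by exists k%:R; rewrite ?shiftX.
by exists i; rewrite shiftX natr_Zp.
Qed.

Lemma mem_cycle_shift i : shift i \in <[s]>%g.
Proof. by rewrite cycle_shift imset_f. Qed.

Lemma order_shift : #[s]%g = p.
Proof. by rewrite orderE cycle_shift card_imset ?card_Fp //; exact: shift_inj. Qed.

Local Notation to := (perm_action 'F_p).
Local Notation tr := (translate (arc_action to)).
Local Notation N := (norm (arc_action to) <[s]>).
Local Notation arc i j := (unit_fun ((i, j) : 'F_p * 'F_p)).

Lemma norm_shiftE x i j : N x (i, j) = \sum_k x (i + k, j + k).
Proof.
rewrite /norm /= cycle_shift big_imset /=; last by move=> ? ? _ _; exact: shift_inj.
rewrite sum_ffunE [RHS](reindex_inj oppr_inj) /=; apply: eq_bigr => k _.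
by rewrite ffunE shiftV /= /arc_move /= /aperm !shiftE.
Qed.

Lemma norm_arcE k i j : N (arc 0 k) (i, j) = (k == j - i)%:R.
Proof.
rewrite norm_shiftE (bigD1 (- i)) //= big1 ?addr0 => [|l li].
  by rewrite ffunE subrr xpair_eqE eqxx eq_sym.
by rewrite ffunE xpair_eqE addrC addr_eq0 (negPf li).
Qed.

(** The cycle of arcs of slope k is k times the cycle of slope 1 modulo norms of
    circulations, as each step adds a triangle 0 -> k -> k + 1 <- 0. *)
Lemma norm_arc_multiple k : exists m,
  boundary m = 0 /\ N (arc 0 k%:R) = N (arc 0 1) *+ k + N m.
Proof.
elim: k => [|k [m [bm mE]]].
  by exists (arc 0 0); rewrite boundary_arc subrr mulr0n add0r.
exists (m + arc 0 k.+1%:R - arc 0 k%:R - arc k%:R k.+1%:R); split.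
  rewrite !(raddfB, raddfD) /= bm !boundary_arc.
  by apply/ffunP=> i; rewrite !ffunE; ring.
have sh : N (arc k%:R k.+1%:R) = N (arc 0 1).
  rewrite -[RHS](norm_translate _ _ (mem_cycle_shift k%:R)) translate_unit /=.
  by rewrite /arc_move /= /aperm !shiftE add0r nat1r.
rewrite 2!raddfB raddfD /= sh mE mulrS.
move: (N (arc 0 1)) (N m) (N _) => A M K.
by apply/ffunP=> i; rewrite !(ffunE, ffunMnE); ring.
Qed.

Lemma cycle_generates m : boundary m = 0 ->
    (forall g, g \in <[s]>%g -> tr g m = m) ->
  exists (a : int) m', boundary m' = 0 /\ m = N (arc 0 1) *~ a + N m'.
Proof.
move=> bm ms.
have /choice[c cP] : forall k : 'F_p, exists c, boundary c = 0 /\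
    N (arc 0 k) = N (arc 0 1) *+ k + N c.
  by move=> k; rewrite -{1}(natr_Zp k); exact: norm_arc_multiple.
exists (\sum_(k : 'F_p) m (0, k) *+ k), (\sum_k c k *~ m (0, k)); split.
  rewrite raddf_sum big1 // => k _; have [bc _] := cP k.
  by rewrite raddfMz /= bc mul0rz.
transitivity (\sum_k N (arc 0 k) *~ m (0, k)).
  apply/ffunP=> -[i j]; rewrite sum_ffunE (bigD1 (j - i)) //= big1 => [|k kij].
    rewrite ffunMzE norm_arcE eqxx intz addr0.
    rewrite -{1}(ms _ (mem_cycle_shift i)) ffunE shiftV /= /arc_move /= /aperm.
    by rewrite !shiftE subrr.
  by rewrite ffunMzE norm_arcE (negPf kij) mul0rz.
rewrite mulrz_sumr raddf_sum -big_split; apply: eq_bigr => k _ /=.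
have [_ ->] := cP k; rewrite mulrzDl raddfMz /=; congr (_ + _).
by rewrite pmulrn -mulrzA mulrC -mulr_natr natz.
Qed.

(** On a circulation m the sum of (j - i) m(i,j) vanishes in F_p, and it is also
    the sum of the k (N m)(0,k), which is 1 for the cycle of slope 1. *)
Lemma cycle_not_norm m : boundary m = 0 -> N (arc 0 1) <> N m.
Proof.
move=> bm Nm.
pose r (z : int) : 'F_p := z%:~R.
have rsum (F : 'F_p -> int) : r (\sum_i F i) = \sum_i r (F i) by exact: raddf_sum.
have one : \sum_k k * r (N m (0, k)) = 1.
  rewrite -Nm (bigD1 1) //= big1 => [|k k1]; rewrite norm_arcE subr0 ?eqxx.
    by rewrite mul1r addr0.
  by rewrite eq_sym (negPf k1) mulr0.
have zero : \sum_k k * r (N m (0, k)) = 0.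
  transitivity (\sum_i \sum_j (j - i) * r (m (i, j))).
    rewrite exchange_big /=.
    transitivity (\sum_k \sum_i k * r (m (i, k + i))).
      apply: eq_bigr => k _; rewrite norm_shiftE rsum mulr_sumr.
      by apply: eq_bigr => i _; rewrite add0r.
    rewrite exchange_big [RHS]exchange_big; apply: eq_bigr => i _ /=.
    rewrite [RHS](reindex_inj (addIr i)) /=.
    by apply: eq_bigr => k _; rewrite addrK.
  transitivity (\sum_k k * r (boundary m k)).
    under [RHS]eq_bigr => k _ do rewrite ffunE /r rmorphB /= -!/(r _) !rsum mulrBr !mulr_sumr.
    rewrite sumrB [X in _ = X - _]exchange_big -sumrB; apply: eq_bigr => i _.
    by rewrite -sumrB; apply: eq_bigr => j _; rewrite mulrBl.
  by rewrite bm big1 // => k _; rewrite ffunE /r mulr0z mulr0.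
by have /eqP := one; rewrite zero eq_sym oner_eq0.
Qed.

Hypothesis p_gt3 : (3 < p)%N.

Lemma two_neq0 : 2%:R != 0 :> 'F_p.
Proof.
rewrite -(dvdn_pcharf (pchar_Fp p_prime)); apply/negP => /dvdn_leq.
by move/(_ isT); rewrite leqNgt (ltn_trans _ p_gt3).
Qed.

Definition doubling : {perm 'F_p} := perm (mulfI two_neq0).

Lemma doublingE x : doubling x = 2%:R * x.
Proof. by rewrite permE. Qed.

Lemma doubling_normaliser : doubling \in 'N(<[s]>)%g.
Proof.
rewrite inE -cycleJ cycle_subG (_ : (s ^ doubling)%g = shift 2%:R).
  exact: mem_cycle_shift.
apply: (mulgI doubling); rewrite -conjgC.
by apply/permP=> x; rewrite !permM !doublingE !shiftE mulrDr mulr1.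
Qed.

(** Both the doubling map and its inverse are put into the trace formula. *)
Lemma prime_not_quasi_permutation_circulations :
  ~ quasi_permutation_circulations to.
Proof.
move=> [I [J [toI [toJ [f [h fh]]]]]].
have sP : prime #[s]%g by rewrite order_shift.
have str i j : exists2 g, g \in <[s]>%g & to i g = j.
  exists (shift (j - i)); first exact: mem_cycle_shift.
  by rewrite /= /aperm shiftE addrC subrK.
have b0 : boundary (N (arc 0 1)) = 0.
  rewrite raddf_sum /=; under eq_bigr do rewrite boundary_translate boundary_arc.
  rewrite -/(norm to <[s]> _) raddfB /=.
  rewrite -[X in norm _ _ X - _](_ : translate to s (unit_fun 0) = _).
    by rewrite norm_translate ?cycle_id // subrr.
  by rewrite translate_unit /= /aperm shiftE add0r.
have m0s g : g \in <[s]>%g -> tr g (N (arc 0 1)) = N (arc 0 1).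
  exact: translate_norm.
have dN := doubling_normaliser.
have trace := fixed_point_trace sP fh str b0 m0s cycle_generates cycle_not_norm.
pose v := fixed_gen s f (N (arc 0 1)).
have vd x : toI x s = x -> v x = 2%:R * v (toI x doubling).
  move=> xs; have [m [bm mE]] := norm_arc_multiple 2.
  have e : f (N (arc 0 1)) x = f (N (arc 0 2%:R)) (toI x doubling).
    have <- : tr doubling (N (arc 0 1)) = N (arc 0 2%:R).
      rewrite translate_norm_normaliser // translate_unit /= /arc_move /= /aperm.
      by rewrite !doublingE mulr0 mulr1.
    by rewrite (circ_equiv fh) // translate_act.
  rewrite /v /fixed_gen e mE raddfD raddfMn /= ffunE ffunMnE mod_pD.
  rewrite (circ_norm s fh bm) mod_p_norm //; last first.
    by apply/eqP; rewrite fixed_normaliser // xs.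
  by rewrite addr0 /mod_p rmorphMn mulr_natl.
have two : 2%:R != 0 :> 'F_#[s]%g by rewrite order_shift; exact: two_neq0.
have t1 := trace doubling 2%:R^-1 dN.
have t2 := trace doubling^-1%g 2%:R.
have fixV (X : finType) (toX : {action {perm 'F_p} &-> X}) :
    \sum_(x | toX x s == x) (toX x doubling^-1%g == x)%:R =
    \sum_(x | toX x s == x) (toX x doubling == x)%:R :> 'F_#[s]%g.
  apply: eq_bigr => x _; congr (_%:R); rewrite eq_sym.
  by rewrite -[in RHS](inj_eq (act_inj toX doubling^-1%g)) actK.
have half : 2%:R^-1 = 2%:R :> 'F_#[s]%g.
  apply: (addrI (\sum_(y | toJ y s == y) (toJ y doubling == y)%:R)).
  rewrite -t1 => [|x xs]; last first.
    by rewrite -!/(v _) (vd x xs) mulKf.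
  rewrite -!fixV t2 ?groupV // => x xs; rewrite -/(v _) vd ?actKV //.
  by apply/eqP; rewrite fixed_normaliser ?groupV ?xs.
have : (#[s]%g %| 3)%N.
  have e3 : 3%:R = 2%:R^-1 * 2%:R - 1 :> 'F_#[s]%g by rewrite half; ring.
  by rewrite (dvdn_pcharf (pchar_Fp sP)) e3 mulVf // subrr.
by rewrite order_shift => /(@dvdn_leq p 3 isT); rewrite leqNgt p_gt3.
Qed.

End PrimeDegree.

Lemma prime_not_quasi_permutation p : prime p -> (3 < p)%N ->
  ~ quasi_permutation (tensor_lattice (root_lattice p) (root_lattice p)).
Proof.
move=> pP p3 qp; apply: (prime_not_quasi_permutation_circulations pP p3).
apply: quasi_permutation_circulations_restrict; rewrite card_Fp //.
by case: (p) p3 qp => // k _; exact: quasi_permutation_root_square.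
Qed.

(** * Degrees two and three *)

Section PermutationLattice.
Variables (gT : finGroupType) (I : finType) (to : {action gT &-> I}).

Lemma zbasis_unit_fun : zbasis (@unit_fun I).
Proof.
move=> x; exists x; split=> [|c ->]; first exact: unit_fun_sum.
by rewrite -unit_fun_sum.
Qed.

Lemma permutation_module_free :
  exists (J : finType) (e : J -> {ffun I -> int}), zbasis e.
Proof. by exists I, (@unit_fun I); exact: zbasis_unit_fun. Qed.

Definition permutation_module : glattice gT :=
  @GLattice gT {ffun I -> int} (fun x g => translate to g x) (translate1 to)
    (fun x g h => translateM to g h x) (translateB to) permutation_module_free.

Lemma permutation_moduleP : permutation_lattice permutation_module.
Proof.
exists I, (@unit_fun I); split=> [|g i]; first exact: zbasis_unit_fun.
by exists (to i g); rewrite /= translate_unit.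
Qed.

End PermutationLattice.

Lemma trivial_move1 (gT : finGroupType) (I : finType) :
  (fun (i : I) (g : gT) => i)^~ 1%g =1 id.
Proof. by []. Qed.

Lemma trivial_moveM (gT : finGroupType) (I : finType) i :
  act_morph (fun (i : I) (g : gT) => i) i.
Proof. by []. Qed.

Definition trivial_action (gT : finGroupType) (I : finType) : {action gT &-> I} :=
  TotalAction (@trivial_move1 gT I) (@trivial_moveM gT I).

Lemma permutation_quasi_permutation (gT : finGroupType) (P : glattice gT) :
  permutation_lattice P -> quasi_permutation P.
Proof.
move=> Pp; pose Q := permutation_module (trivial_action gT void).
have idB : zmod_morphism (id : P -> P) by [].
have zB : zmod_morphism (fun _ : P => 0 : Q) by move=> x y; rewrite subrr.
pose mi := GRing.isZmodMorphism.Build _ _ (id : P -> P) idB.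
pose mz := GRing.isZmodMorphism.Build _ _ (fun _ : P => 0 : Q) zB.
pose i : {additive P -> P} := HB.pack (id : P -> P) mi.
pose z : {additive P -> Q} := HB.pack (fun _ : P => 0 : Q) mz.
have Q0 (x : Q) : x = 0 by apply/ffunP=> -[].
exists P, Q, i, z; split=> //; first exact: permutation_moduleP.
split=> //; first by move=> y; split=> // _; exists y.
by move=> q; exists 0; rewrite [RHS]Q0.
Qed.

(** The transposition acts as -1 on the root lattice of rank 1, hence trivially on
    its tensor square. *)
Lemma root_square2_permutation :
  permutation_lattice (tensor_lattice (root_lattice 2) (root_lattice 2)).
Proof.
pose r : root_vec 2 := root_diff ord0 ord_max.
have rb : zbasis (fun _ : unit => r).
  have coef (c : unit -> int) : root_val (\sum_i r *~ c i) 0 ord0 = c tt.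
    rewrite coord_sum (bigD1 tt) //= big1 => [|[] //].
    by rewrite coordM /r root_diffE addr0 subr0 intz.
  move=> x; exists [ffun=> root_val x 0 ord0]; split=> [|c ->]; last first.
    by apply/ffunP=> -[]; rewrite ffunE coef.
  rewrite [LHS](root_decomposition x ord_max) (bigD1 ord_max) //= (bigD1 ord0) //=.
  rewrite big1 => [|[[|[|]] ?] //]; rewrite (bigD1 tt) //= big1 => [|[] //].
  rewrite ffunE !addr0 (_ : root_diff ord_max ord_max = 0) ?mul0rz ?add0r //.
  by apply: root_inj => k; rewrite root_diffE subrr mxE.
exists (unit * unit)%type, (fun _ => tens r r); split.
  exact: (zbasis_tens rb rb).
move=> s _; exists (tt, tt); rewrite /= tens_actE /= root_diff_act.
have [s0|s0] := eqVneq (s ord0) ord0.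
  have -> : s ord_max = ord_max.
    have : s ord_max != s ord0 by rewrite (inj_eq perm_inj).
    by rewrite s0; case: (s ord_max) => [[|[|]] lt] // _; apply: val_inj.
  by rewrite s0.
have {}s0 : s ord0 = ord_max.
  by move: s0; case: (s ord0) => [[|[|]] lt] // _; apply: val_inj.
have -> : s ord_max = ord0.
  have : s ord_max != s ord0 by rewrite (inj_eq perm_inj).
  by rewrite s0; case: (s ord_max) => [[|[|]] lt] // _; apply: val_inj.
have -> : root_diff (s ord0) ord0 = r *~ (-1).
  rewrite s0; apply: root_inj => k; rewrite coordM !root_diffE.
  by rewrite mulrzz; ring.
by rewrite tensMl tensMr -mulrzA.
Qed.

Section Triangle.

Definition v0 : 'I_3 := @Ordinal 3 0 isT.
Definition v1 : 'I_3 := @Ordinal 3 1 isT.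
Definition v2 : 'I_3 := @Ordinal 3 2 isT.

Lemma vertexP (i : 'I_3) : [\/ i = v0, i = v1 | i = v2].
Proof.
case: i => [[|[|[|]]] lt] //; [apply: Or31|apply: Or32|apply: Or33];
  exact: val_inj.
Qed.

Lemma sum_vertices (V : zmodType) (F : 'I_3 -> V) : \sum_i F i = F v0 + F v1 + F v2.
Proof.
rewrite !big_ord_recl big_ord0 addr0 addrA.
by congr (F _ + F _ + F _); exact: val_inj.
Qed.

Lemma sum_other_vertices (V : zmodType) (F : 'I_3 -> V) i j :
  \sum_(l | (l != i) && (l != j)) F l =
    (if (v0 != i) && (v0 != j) then F v0 else 0)
    + (if (v1 != i) && (v1 != j) then F v1 else 0)
    + (if (v2 != i) && (v2 != j) then F v2 else 0).
Proof. by rewrite big_mkcond sum_vertices. Qed.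

(** For i != j, whether the arc from i to j lies on 0 -> 1 -> 2 -> 0. *)
Definition counterclockwise (i j : 'I_3) : bool := j == (i.+1 %% 3)%N :> nat.

Lemma counterclockwiseE :
  (counterclockwise v0 v1 = true) * (counterclockwise v1 v2 = true) *
  (counterclockwise v2 v0 = true) * (counterclockwise v1 v0 = false) *
  (counterclockwise v2 v1 = false) * (counterclockwise v0 v2 = false).
Proof. by []. Qed.

Lemma counterclockwise_perm (s : 'S_3) i j : i != j ->
  counterclockwise (s i) (s j) =
  counterclockwise i j (+) ~~ counterclockwise (s v0) (s v1).
Proof.
have s01 : s v0 != s v1 by rewrite (inj_eq perm_inj).
have s02 : s v0 != s v2 by rewrite (inj_eq perm_inj).
have s12 : s v1 != s v2 by rewrite (inj_eq perm_inj).
move: s01 s02 s12.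
case: (vertexP i) => ->; case: (vertexP j) => -> //;
by case: (vertexP (s v0)) => ->; case: (vertexP (s v1)) => -> //;
  case: (vertexP (s v2)) => -> //.
Qed.

(** The two orientations of the triangle, exchanged by the odd permutations. *)
Definition orientation_move (b : bool) (s : 'S_3) : bool :=
  b (+) ~~ counterclockwise (s v0) (s v1).

Lemma orientation_move1 : orientation_move^~ 1%g =1 id.
Proof. by move=> b; rewrite /orientation_move !perm1 addbF. Qed.

Lemma orientation_moveM b : act_morph orientation_move b.
Proof.
move=> s t; rewrite /orientation_move !permM counterclockwise_perm.
  by case: b; do 2!case: counterclockwise.
by rewrite (inj_eq perm_inj).
Qed.

Definition orientation_action : {action 'S_3 &-> bool} :=
  TotalAction orientation_move1 orientation_moveM.

Local Notation I := ('I_3 + bool)%type.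
Local Notation arcs := ('I_3 * 'I_3)%type.
Local Notation toI := (sum_action (perm_action 'I_3) orientation_action).
Local Notation tr := (translate (arc_action (perm_action 'I_3))).

(** The circulation that runs both ways through the edge opposite to each vertex
    and around each of the two oriented triangles, w giving the multiplicities;
    true stands for the triangle 0 -> 1 -> 2 -> 0. *)
Definition triangle_circ (w : {ffun I -> int}) : {ffun arcs -> int} :=
  [ffun k => if k.1 == k.2 then 0 else
    \sum_(l | (l != k.1) && (l != k.2)) w (inl l)
      + w (inr (counterclockwise k.1 k.2))].

Lemma triangle_circ_act s w :
  triangle_circ (translate toI s w) = tr s (triangle_circ w).
Proof.
apply/ffunP=> -[i j]; rewrite !ffunE /= /aperm (inj_eq perm_inj).
case: eqP => // /eqP ij; congr (_ + _).
  rewrite [RHS](reindex_inj (@perm_inj _ s^-1%g)) /=.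
  by apply: eq_big => [l|l _]; rewrite ?(inj_eq perm_inj) // ffunE.
congr (w (inr _)).
by rewrite [RHS]counterclockwise_perm.
Qed.

Lemma boundary_triangle_circ w : boundary (triangle_circ w) = 0.
Proof.
apply/ffunP=> k; rewrite !ffunE !sum_vertices !ffunE /=.
by case: (vertexP k) => ->; rewrite !sum_other_vertices !counterclockwiseE /=; ring.
Qed.

(** Here c is the flow through the arcs 0 -> 1 -> 2 -> 0, and d is the excess of the
    reverse of an arc over the arc, which is the same for these three arcs if x
    is a circulation. The multiplicities are determined up to adding 1 to
    those of the edges and -1 to those of the triangles; taking sum zero yields
    c + d and c + 2 d for the triangles. *)
Definition triangle_coord (x : {ffun arcs -> int}) : {ffun I -> int} :=
  let c := x (v0, v1) + x (v1, v2) + x (v2, v0) in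
  let d := x (v1, v0) - x (v0, v1) in
  [ffun k => match k with
    | inl l => (if l == v0 then x (v1, v2) else
        if l == v1 then x (v2, v0) else x (v0, v1)) - (c + d)
    | inr b => c + d + if b then 0 else d
    end].

Definition total (w : {ffun I -> int}) : {ffun unit -> int} :=
  [ffun => \sum_k w k].

Lemma totalE w : total w tt =
  w (inl v0) + w (inl v1) + w (inl v2) + w (inr true) + w (inr false).
Proof.
by rewrite ffunE big_sumType /= sum_vertices big_bool addrA.
Qed.

Lemma triangle_circK w : total w = 0 ->
  triangle_coord (tens_matrix (circ_tens (triangle_circ w))) = w.
Proof.
move=> /ffunP/(_ tt); rewrite totalE ffunE => w0.
have bw := boundary_triangle_circ w.
apply/ffunP=> k; rewrite ffunE /= !(circ_tens_off_diagonal bw) //.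
rewrite !ffunE /= !sum_other_vertices !counterclockwiseE /=.
move: w0; case: k => [k|[]]; [case: (vertexP k) => -> /=| |];
  by move: (w (inl v0)) (w (inl v1)) (w (inl v2)) (w (inr true)) (w (inr false));
  lia.
Qed.

Lemma triangle_coordK m : circ_tens (triangle_circ (triangle_coord (tens_matrix m))) = m.
Proof.
rewrite -[RHS]tens_matrixK; have := boundary_tens_matrix m.
move: (tens_matrix m) => x bx.
have b0 := congr1 (fun y : {ffun 'I_3 -> int} => y v0) bx.
have b1 := congr1 (fun y : {ffun 'I_3 -> int} => y v1) bx.
have b2 := congr1 (fun y : {ffun 'I_3 -> int} => y v2) bx.
move: b0 b1 b2; rewrite !ffunE !sum_vertices => b0 b1 b2.
apply: circ_tens_loops => i j; rewrite !ffunE /=.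
case: (vertexP i) => ->; case: (vertexP j) => -> //= _;
  rewrite sum_other_vertices ?counterclockwiseE !ffunE /=; move: b0 b1 b2;
  move: (x (v0, v0)) (x (v0, v1)) (x (v0, v2)) (x (v1, v0)) (x (v1, v1))
    (x (v1, v2)) (x (v2, v0)) (x (v2, v1)) (x (v2, v2)); lia.
Qed.

Lemma total_triangle_coord m : total (triangle_coord (tens_matrix m)) = 0.
Proof.
have := boundary_tens_matrix m; move: (tens_matrix m) => x bx.
have b0 := congr1 (fun y : {ffun 'I_3 -> int} => y v0) bx.
have b1 := congr1 (fun y : {ffun 'I_3 -> int} => y v1) bx.
have b2 := congr1 (fun y : {ffun 'I_3 -> int} => y v2) bx.
move: b0 b1 b2; rewrite !ffunE !sum_vertices => b0 b1 b2.
apply/ffunP=> -[]; rewrite totalE !ffunE /=; move: b0 b1 b2.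
move: (x (v0, v0)) (x (v0, v1)) (x (v0, v2)) (x (v1, v0)) (x (v1, v1))
    (x (v1, v2)) (x (v2, v0)) (x (v2, v1)) (x (v2, v2)); lia.
Qed.

(** The maps triangle_coord and triangle_circ are inverse bijections between the
    tensor square and the kernel of total; equivariance is visible on the
    second and so passes to the first. *)
Lemma root_square3_quasi_permutation :
  quasi_permutation (tensor_lattice (root_lattice 3) (root_lattice 3)).
Proof.
pose P := permutation_module toI.
pose Q := permutation_module (trivial_action 'S_3 unit).
pose M := tensor_lattice (root_lattice 3) (root_lattice 3).
pose F (m : M) : P := triangle_coord (tens_matrix m).
have FB : zmod_morphism F.
  move=> x y; rewrite /F raddfB; apply/ffunP=> -[l|b]; rewrite !ffunE.
    by case: ifP => _; [|case: ifP => _]; ring.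
  by case: b; ring.
have tB : zmod_morphism (total : P -> Q).
  move=> x y; apply/ffunP=> -[]; rewrite ![in RHS]ffunE ffunE -sumrB.
  by apply: eq_bigr => k _; rewrite !ffunE.
pose mF := GRing.isZmodMorphism.Build _ _ F FB.
pose mt := GRing.isZmodMorphism.Build _ _ (total : P -> Q) tB.
pose f : {additive M -> P} := HB.pack F mF.
pose h : {additive P -> Q} := HB.pack (total : P -> Q) mt.
have total_act s (w : P) : total (translate toI s w) = total w.
  apply/ffunP=> -[]; rewrite !ffunE [RHS](reindex_inj (act_inj toI s^-1%g)).
  by apply: eq_bigr => k _; rewrite ffunE.
exists P, Q, f, h; split; try exact: permutation_moduleP.
- move=> m s; rewrite /= /F.
  set w := triangle_coord (tens_matrix m).
  have w0 : total (translate toI s w) = 0 by rewrite total_act total_triangle_coord.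
  rewrite -(triangle_circK w0) triangle_circ_act circ_tens_act.
    by rewrite triangle_coordK.
  exact: boundary_triangle_circ.
- by move=> w s; rewrite /= total_act; apply/ffunP=> -[]; rewrite !ffunE.
split.
- by move=> x y /= e; rewrite -(triangle_coordK x) -/(F x) e triangle_coordK.
- move=> w; split=> [w0|[m <-]]; last exact: total_triangle_coord.
  by exists (circ_tens (triangle_circ w)); exact: triangle_circK.
move=> z; exists (unit_fun (inl v0) *~ z tt : {ffun I -> int}).
by apply/ffunP=> -[]; rewrite /= totalE !ffunMzE !ffunE /= !mul0rz !addr0 intz.
Qed.

End Triangle.

Local Close Scope ring_scope.
Unset Implicit Arguments.

Theorem mainTheorem5 (n : nat) (hn : (2 <= n)%N) :
  quasi_permutation (tensor_lattice (root_lattice n) (root_lattice n)) <->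
  n = 2%N \/ n = 3%N.
Proof.
split=> [qp|[->|->]]; first last.
- exact: root_square3_quasi_permutation.
- exact: permutation_quasi_permutation root_square2_permutation.
have [nP|nP] := boolP (prime n); last first.
  by case: (composite_not_quasi_permutation hn nP).
have [n3|] := ltnP 3 n; first by case: (prime_not_quasi_permutation nP n3).
by case: n hn {qp nP} => [|[|[|[|]]]] // _ _; [left | right].
Qed.
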